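(* Let $n\ge 2$, let $0\le\alpha<\beta\le\infty$, and let $g$ be a $\mathrm{U}(n)$-invariant Kähler metric with Kähler potential $\phi(\mathbf z)$ on the annulus $\mathcal A_{\alpha,\beta}\subset(\mathbb C^n,J_0)$. Let $$v=\Big(\int\frac{1}{\mathbf z^{n}(\phi')^{n-1}}\,d\mathbf z\Big)^{\frac{1}{2n-1}},$$ where the integral denotes an antiderivative in the variable $\mathbf z$ whose constant of integration is chosen so that $v$ does not vanish on $\mathcal A_{\alpha,\beta}$. Then the conformal metric $(v^2 g,J_0)$ is a non-Kähler Hermitian Klsc metric on $\mathcal A_{\alpha,\beta}$. Furthermore, up to scale and the constant of integration, this is the unique $\mathrm{U}(n)$-invariant conformal factor with this property: if $\rho(\mathbf z)$ is a smooth positive function on $\mathcal A_{\alpha,\beta}$ such that $(\rho\, g,J_0)$ is a non-Kähler Hermitian Klsc metric, then $\rho=c\,v^2$ for some constant $c>0$ and some choice of the constant of integration in the formula for $v$.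
   Context: $J_0$ is the standard complex structure on $\mathbb C^n$, $\mathbf z=\sum_{i=1}^n|z_i|^2$ is the radial variable, and $\mathcal A_{\alpha,\beta}=\{(z_1,\dots,z_n)\in\mathbb C^n: \alpha<\mathbf z<\beta\}$ (so the origin is excluded). Primes denote derivatives with respect to $\mathbf z$. The $(2n-1)$-th root is the real odd root. A Riemannian metric $g$ on a complex manifold $(M,J)$ is Hermitian if $g(JX,JY)=g(X,Y)$; its associated 2-form is $\omega(\cdot,\cdot)=g(J\cdot,\cdot)=\sqrt{-1}\sum_{i,j} g_{i\bar j}\,dz_i\wedge d\bar z_j$ with $g_{i\bar j}=g(\partial_{z_i},\partial_{\bar z_j})$, and $g$ is Kähler if $d\omega=0$. A $\mathrm{U}(n)$-invariant Kähler metric with Kähler potential $\phi(\mathbf z)$ is the one with associated 2-form $\omega=\sqrt{-1}\,\partial\bar\partial\phi(\mathbf z)$, where $\phi$ is a smooth function of $\mathbf z$ with $\phi'>0$ and $(\mathbf z\phi')'>0$. The Riemannian scalar curvature $S$ is that of the Levi-Civita connection of $g$. The Chern scalar curvature is $S_C=g^{i\bar j}\Theta_{i\bar j}$, where $\sqrt{-1}\,\Theta_{i\bar j}\,dz_i\wedge d\bar z_j=-\sqrt{-1}\,\partial\bar\partial\log\det(g_{i\bar j})$. A Hermitian metric is a Kähler like scalar curvature (Klsc) metric if $S=2S_C$. *)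

(* Defs.v *)
From HB Require Import structures.
From mathcomp Require Import all_boot all_order all_algebra.
From mathcomp Require Import all_classical all_reals all_analysis.
From mathcomp Require Import complex.

Set Implicit Arguments.
Unset Strict Implicit.
Unset Printing Implicit Defensive.

Import Order.TTheory GRing.Theory Num.Theory.
Import numFieldNormedType.Exports.

Local Open Scope ring_scope.
Local Open Scope classical_set_scope.
Local Open Scope complex_scope.

(* C^n is identified with R^(2n): the point (z_1, .., z_n) with
   z_j = x_j + i y_j is the row vector (x_1, .., x_n, y_1, .., y_n).
   A tensor field is given by its components in the coordinate frame
   d/dx_1, .., d/dx_n, d/dy_1, .., d/dy_n. *)

Section RealGeometry.
Context {R : realType} {m : nat}.
Implicit Types (U : set 'rV[R]_m) (p : 'rV[R]_m) (g : 'rV[R]_m -> 'M[R]_m).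

Definition pd (a : 'I_m) (f : 'rV[R]_m -> R) : 'rV[R]_m -> R :=
  fun p => 'D_(delta_mx 0 a) f p.

(* C^oo on the open set U: every iterated partial derivative is
   differentiable, hence continuous, at each point of U. *)
Definition smooth_on U (f : 'rV[R]_m -> R) : Prop :=
  forall (s : seq 'I_m) p, U p -> differentiable (foldr pd f s) p.

Definition riemannian_metric U g : Prop :=
  [/\ forall a b, smooth_on U (fun p => g p a b),
      forall p, U p -> (g p)^T = g p
    & forall p (u : 'rV[R]_m), U p -> u != 0 -> 0 < (u *m g p *m u^T) 0 0].

(* Levi-Civita connection: nabla_(d_i) d_j = sum_k (christoffel g k i j) d_k *)
Definition christoffel g (k i j : 'I_m) : 'rV[R]_m -> R := fun p =>
  2^-1 * \sum_(l < m) invmx (g p) k l *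
    (pd i (fun q => g q j l) p + pd j (fun q => g q i l) p
     - pd l (fun q => g q i j) p).

(* R(d_i, d_j) d_k = sum_l (riemann_curv g l i j k) d_l, with
   R(X, Y) = [nabla_X, nabla_Y] - nabla_[X, Y] *)
Definition riemann_curv g (l i j k : 'I_m) : 'rV[R]_m -> R := fun p =>
  pd i (christoffel g l j k) p - pd j (christoffel g l i k) p
  + \sum_(r < m) (christoffel g r j k p * christoffel g l i r p
                  - christoffel g r i k p * christoffel g l j r p).

Definition ricci g (j k : 'I_m) : 'rV[R]_m -> R := fun p =>
  \sum_(i < m) riemann_curv g i i j k p.

Definition scalar_curv g : 'rV[R]_m -> R := fun p =>
  \sum_(j < m) \sum_(k < m) invmx (g p) j k * ricci g j k p.

(* The 2-form w has components w p a b = w_p(d_a, d_b). *)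
Definition closed2 U (w : 'rV[R]_m -> 'M[R]_m) : Prop :=
  forall p a b c, U p ->
    pd a (fun q => w q b c) p + pd b (fun q => w q c a) p
    + pd c (fun q => w q a b) p = 0.

End RealGeometry.

Section ComplexGeometry.
Context {R : realType} {n : nat}.
Local Notation pt := 'rV[R]_(n + n).
Implicit Types (U : set pt) (p : pt) (g : pt -> 'M[R]_(n + n)).

(* X *m J0 is J_0 X: J_0 (d/dx_j) = d/dy_j and J_0 (d/dy_j) = - d/dx_j *)
Definition J0 : 'M[R]_(n + n) := block_mx 0 1%:M (- 1%:M) 0.

(* g(JX, JY) = g(X, Y) *)
Definition hermitian_metric U g : Prop :=
  riemannian_metric U g /\
  forall p (X Y : pt), U p ->
    (X *m J0) *m g p *m (Y *m J0)^T = X *m g p *m Y^T.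

(* w(X, Y) = g(JX, Y) *)
Definition assoc_form g : pt -> 'M[R]_(n + n) := fun p => J0 *m g p.

Definition kahler_metric U g : Prop :=
  hermitian_metric U g /\ closed2 U (assoc_form g).

(* Row i: components of d/dz_i = (d/dx_i - i d/dy_i) / 2 *)
Definition dz_vec : 'M[R[i]]_(n, n + n) :=
  2^-1 *: row_mx 1%:M (- 'i%C)%:M.
Definition dzbar_vec : 'M[R[i]]_(n, n + n) :=
  2^-1 *: row_mx 1%:M 'i%C%:M.

(* Column i: values of dz_i = dx_i + i dy_i on the coordinate frame *)
Definition dz_form : 'M[R[i]]_(n + n, n) := col_mx 1%:M 'i%C%:M.
Definition dzbar_form : 'M[R[i]]_(n + n, n) := col_mx 1%:M (- 'i%C)%:M.

(* h p i j = g(d/dz_i, d/dzbar_j), for g extended C-bilinearly *)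
Definition hermitian_mx g : pt -> 'M[R[i]]_n := fun p =>
  dz_vec *m map_mx (real_complex R) (g p) *m dzbar_vec^T.

(* The 2-form sqrt(-1) sum_ij h_ij dz_i /\ dzbar_j *)
Definition form11 (h : 'M[R[i]]_n) : 'M[R[i]]_(n + n) :=
  let T := dz_form *m h *m dzbar_form^T in 'i%C *: (T - T^T).

Definition pdC (a : 'I_(n + n)) (f : pt -> R[i]) : pt -> R[i] := fun p =>
  pd a (fun q => complex.Re (f q)) p +i* pd a (fun q => complex.Im (f q)) p.

Definition del (i : 'I_n) (f : pt -> R[i]) : pt -> R[i] := fun p =>
  2^-1 * (pdC (lshift n i) f p - 'i%C * pdC (rshift n i) f p).
Definition delbar (i : 'I_n) (f : pt -> R[i]) : pt -> R[i] := fun p =>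
  2^-1 * (pdC (lshift n i) f p + 'i%C * pdC (rshift n i) f p).

Definition ddbar (f : pt -> R) : pt -> 'M[R[i]]_n := fun p =>
  \matrix_(i, j) del i (delbar j (fun q => (f q)%:C)) p.

(* det (g_{i jbar}) is a positive real number, so its logarithm is taken
   through its real part. *)
Definition chern_ricci g : pt -> 'M[R[i]]_n := fun p =>
  - ddbar (fun q => ln (complex.Re (\det (hermitian_mx g q)))) p.

(* g^{i jbar}, with sum_j g^{i jbar} g_{k jbar} = delta_ik, is the (j, i)
   entry of the inverse matrix. *)
Definition chern_scalar g : pt -> R[i] := fun p =>
  \sum_(i < n) \sum_(j < n) invmx (hermitian_mx g p) j i * chern_ricci g p i j.

Definition klsc_metric U g : Prop :=
  hermitian_metric U g /\
  forall p, U p -> (scalar_curv g p)%:C = 2 * chern_scalar g p.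

Definition non_kahler_klsc U g : Prop :=
  klsc_metric U g /\ ~ kahler_metric U g.

(* |z_1|^2 + .. + |z_n|^2 *)
Definition radial p : R :=
  \sum_(j < n) (p 0 (lshift n j) ^+ 2 + p 0 (rshift n j) ^+ 2).

End ComplexGeometry.

Section Radial.
Context {R : realType}.

(* The open interval ]a, b[, where b may be +oo *)
Definition oint (a : R) (b : \bar R) : set R :=
  [set t | a < t /\ (t%:E < b)%E].

Definition annulus (n : nat) (a : R) (b : \bar R) : set 'rV[R]_(n + n) :=
  [set p | oint a b (radial p)].

Arguments annulus : clear implicits.

Definition smooth1_on (I : set R) (f : R -> R) : Prop :=
  forall k t, I t -> derivable (derive1n k f) t 1.

(* g is the Kahler metric on the annulus with Kahler potential phi(|z|^2):
   its associated 2-form is sqrt(-1) del delbar phi. *)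
Definition kahler_potential (n : nat) (a : R) (b : \bar R) (phi : R -> R)
    (g : 'rV[R]_(n + n) -> 'M[R]_(n + n)) : Prop :=
  [/\ smooth1_on (oint a b) phi,
      forall t, oint a b t -> 0 < derive1 phi t,
      forall t, oint a b t -> 0 < derive1 (fun s => s * derive1 phi s) t
    & forall p, annulus n a b p ->
        map_mx (real_complex R) (assoc_form g p)
        = form11 (ddbar (fun q => phi (radial q)) p)].

(* The real m-th root, for m odd *)
Definition odd_root (m : nat) (x : R) : R := Num.sg x * `|x| `^ (m%:R^-1).

(* v is (int dz / (z^n (phi')^(n-1)))^(1/(2n-1)) for an antiderivative (that is,
   a constant of integration) such that v does not vanish. *)
Definition klsc_factor (n : nat) (a : R) (b : \bar R) (phi v : R -> R) : Prop :=
  exists F : R -> R,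
    [/\ forall t, oint a b t ->
          is_derive t 1 F (t ^+ n * derive1 phi t ^+ (n - 1))^-1,
        forall t, oint a b t -> v t = odd_root (2 * n - 1) (F t)
      & forall t, oint a b t -> v t != 0].

End Radial.

Arguments annulus {R} n a b p.

(* Main.v *)
Require Import Defs.
From mathcomp Require Import all_boot all_order all_algebra.
From mathcomp Require Import all_classical all_reals all_analysis.
From mathcomp Require Import complex ring lra.
Import numFieldNormedType.Exports.
Local Open Scope ring_scope.

(** Write m = 2n for the real dimension, r for the squared norm of p, phi1,
    phi2, .. for the derivatives of phi, psi = (t phi1)' = phi1 + t phi2, and
    l = rho' / rho for a radial conformal factor rho. For every metric g on an
    m-dimensional manifold, with u = log(rho) / 2 and Delta u = g^jk u_;jk,
      rho S(rho g) = S(g) - 2 (m - 1) Delta u - (m - 1)(m - 2) |du|^2,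
    while det(rho g_ij) = rho^n det(g_ij) gives
      2 rho S_C(rho g) = 2 S_C(g) - 2 n Delta u
    when g is Kahler. As S(g) = 2 S_C(g) in the Kahler case, rho g is Klsc iff
    Delta u + (2n - 1) |du|^2 = 0, that is iff rho^((2n-1)/2) is harmonic. A
    radial function F is harmonic iff W F' is constant, W = t^n phi1^(n-1),
    so F is an antiderivative of 1/W up to scale and an additive constant, and
    rho = |F|^(2/(2n-1)). Finally d(rho omega) = d rho /\ omega vanishes only
    where d rho does, because omega has rank at least 4: non-Kahler means that
    F is not constant.

    The curvature computation rests on one observation. Let s be the involution
    exchanging the coordinates x_i and y_i, and e = 1, -1 the signs with
    J (d/dx_a) = e_a d/dx_(s a). Closedness of omega makes Gamma complex
    bilinear:
      Gamma^(s l)_(j, s k) = e_l e_k Gamma^l_jk   (christoffelJ),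
    so that Gamma, its derivatives and the quadratic term Gamma Gamma of the
    Ricci tensor all change sign under J x J, whereas g^jk is invariant. Their
    g-traces vanish (contract_J0), and what remains of S(g) is
    - g^jk d_j d_k log sqrt(det g). The same cancellations reduce the scalar
    curvature of rho g to finite sums over a bilinear correction of Gamma
    (contract_conformal_ricci), without any further curvature identity.

    For g with potential phi(r) everything is then explicit:
    g = 2 phi1 + 2 phi2 M with M = p^T p + (pJ)^T (pJ) and M^2 = r M, so inverse
    and traces are rational in phi1, phi2 and r; on the complex side
    g_ij = phi1 delta_ij + phi2 zbar_i z_j, with determinant phi1^(n-1) psi.
    Both scalar curvatures become functions of r (scalar_curv_rg and
    chern_scalar_rg), and their equality is the equation (klsc_iff_ode)
      l' + (2n - 1)/2 l^2 + l W' / W = 0,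
    whose nonzero solutions are l = 2 / ((2n - 1) W F) with F' = 1 / W. *)

Set Implicit Arguments.
Unset Strict Implicit.
Unset Printing Implicit Defensive.

Import Order.TTheory GRing.Theory Num.Theory.

Local Open Scope classical_set_scope.
Local Open Scope complex_scope.

(** * Directional derivatives and smooth functions *)

Section DirectionalDerivatives.
Context {R : realType} {V : normedModType R}.
Implicit Types (f h : V -> R) (v x : V).

(** Differentiability is part of the relation so that it survives composition;
    the mere existence of a directional derivative does not. *)
Definition hasD v f x (d : R) : Prop := differentiable f x /\ 'D_v f x = d.

Lemma hasD_differentiable v f x d : hasD v f x d -> differentiable f x.
Proof. by case. Qed.

Lemma hasD_val v f x d : hasD v f x d -> 'D_v f x = d.
Proof. by case. Qed.

Lemma differentiable_hasD v f x : differentiable f x -> hasD v f x ('D_v f x).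
Proof. by []. Qed.

Lemma hasD_eq v f x d d' : hasD v f x d -> d = d' -> hasD v f x d'.
Proof. by move=> ? <-. Qed.

Lemma hasD_ext v f h x d : f =1 h -> hasD v f x d -> hasD v h x d.
Proof. by move=> /funext ->. Qed.

(** The first-order expansion at x only involves the germ of the function, so it
    is also the expansion of the other function. *)
Lemma near_eq_differentiable f h x :
  (\near x, f x = h x) -> differentiable f x -> differentiable h x.
Proof.
move=> fh df; have [cf dfE] := (diff_locallyP _ _).1 df.
have fhx : f x = h x := nbhs_singleton fh.
have E : h \o shift x = cst (h x) + 'd f x +o_ 0 id.
  apply/eqaddoP => e e0; have := (eqaddoP _ _ _ _).1 dfE e e0.
  have fh0 : \forall k \near (0 : V), f (k + x) = h (k + x).
    have := fh; rewrite (near_shift 0 x)/=.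
    by apply: filterS => k; rewrite /= subr0.
  apply: filterS2 fh0 => k fhk.
  by rewrite !fctE /= fhx fhk.
have dE := diff_unique cf E.
by apply/diff_locallyP; rewrite dE.
Qed.

Lemma hasD_near v f h x d :
  (\near x, f x = h x) -> hasD v f x d -> hasD v h x d.
Proof.
move=> fh [df <-]; split; first exact: near_eq_differentiable df.
by apply/esym/near_eq_derive.
Qed.

Lemma hasD_on (U : set V) v f h x d : open U -> U x ->
  (forall y, U y -> f y = h y) -> hasD v f x d -> hasD v h x d.
Proof.
move=> oU Ux fh; apply: hasD_near; near=> y; apply: fh; near: y.
exact: open_nbhs_nbhs.
Unshelve. all: by end_near. Qed.

Lemma hasD_cst v (c : R) x : hasD v (fun=> c) x 0.
Proof. by split; [exact: differentiable_cst|rewrite derive_cst]. Qed.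

Lemma hasD_D v f h x a b : hasD v f x a -> hasD v h x b ->
  hasD v (fun y => f y + h y) x (a + b).
Proof.
move=> [df <-] [dh <-]; split; first exact: differentiableD.
by rewrite (_ : (fun _ => _) = f + h)// deriveD//; exact: diff_derivable.
Qed.

Lemma hasD_N v f x a : hasD v f x a -> hasD v (fun y => - f y) x (- a).
Proof.
move=> [df <-]; split; first exact: differentiableN.
by rewrite (_ : (fun _ => _) = - f)// deriveN//; exact: diff_derivable.
Qed.

Lemma hasD_B v f h x a b : hasD v f x a -> hasD v h x b ->
  hasD v (fun y => f y - h y) x (a - b).
Proof. by move=> fa hb; apply: hasD_D => //; apply: hasD_N. Qed.

Lemma hasD_M v f h x a b : hasD v f x a -> hasD v h x b ->
  hasD v (fun y => f y * h y) x (a * h x + f x * b).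
Proof.
move=> [df <-] [dh <-]; split; first exact: differentiableM.
rewrite (_ : (fun _ => _) = f * h)// deriveM//; [|exact: diff_derivable..].
by rewrite addrC mulrC.
Qed.

Lemma hasD_Ml v (c : R) f x a : hasD v f x a ->
  hasD v (fun y => c * f y) x (c * a).
Proof.
move=> fa; apply: hasD_eq (hasD_M (hasD_cst v c x) fa) _.
by rewrite mul0r add0r.
Qed.

Lemma hasD_V v f x a : f x != 0 -> hasD v f x a ->
  hasD v (fun y => (f y)^-1) x (- a / f x ^+ 2).
Proof.
move=> fx0 [df <-]; split; first exact: differentiableV.
rewrite deriveV//; last exact: diff_derivable.
by rewrite /GRing.scale/= !mulNr mulrC.
Qed.

Lemma hasD_X v f x a k : hasD v f x a ->
  hasD v (fun y => f y ^+ k) x (k%:R * f x ^+ k.-1 * a).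
Proof.
elim: k => [|k IH] fa.
  by apply: hasD_ext (hasD_eq (hasD_cst v 1 x) _) => //; rewrite !mul0r.
apply: hasD_ext (hasD_eq (hasD_M fa (IH fa)) _) => [y|]; first by rewrite exprS.
case: k {IH} => [|k] /=; first by ring.
by rewrite !exprS [in RHS]mulrS; ring.
Qed.

Lemma hasD_sum v m (F : 'I_m -> V -> R) x (a : 'I_m -> R) :
  (forall i, hasD v (F i) x (a i)) ->
  hasD v (fun y => \sum_i F i y) x (\sum_i a i).
Proof.
move=> Fa; split.
  rewrite (_ : (fun _ => _) = \sum_i F i); last first.
    by apply/funext => y; rewrite fct_sumE.
  by apply: differentiable_sum => i; case: (Fa i).
rewrite (_ : (fun _ => _) = \sum_i F i); last first.
  by apply/funext => y; rewrite fct_sumE.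
rewrite derive_sum => [|i]; last by apply: diff_derivable; case: (Fa i).
by apply: eq_bigr => i _; case: (Fa i).
Qed.

End DirectionalDerivatives.

Lemma hasD_comp {R : realType} {V : normedModType R} v (k : R -> R) (f : V -> R) x a b :
  hasD (1 : R) k (f x) a -> hasD v f x b ->
  hasD v (fun y => k (f y)) x (a * b).
Proof.
move=> [dk <-] [df <-]; split; first exact: (differentiable_comp df dk).
rewrite (_ : (fun _ => _) = k \o f)// !deriveE//; last exact: differentiable_comp.
rewrite diff_comp//= -[X in 'd k _ X]mulr1 -[_ * 1]/(_ *: (1 : R)) linearZ.
by rewrite mulrC.
Qed.

Lemma is_derive_hasD {R : realType} (f : R -> R) (t d : R) :
  is_derive t 1 f d <-> hasD (1 : R) f t d.
Proof.
split=> [[df E]|[df E]]; first by split=> //; apply/derivable1_diffP.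
by apply: DeriveDef => //; apply: diff_derivable.
Qed.

Section Smoothness.
Context {R : realType} {V : normedModType R} {J : Type} (e : J -> V).
Context (U : set V) (oU : open U).
Implicit Types (f h : V -> R).

(** Functions of class C^k on U in the directions e, by recursion on the order:
    the closure properties below are then inductions in which the derivative of
    a product, an inverse or a composite is again built from functions of class
    C^k. One variable and several variables are the cases of one direction and
    of a coordinate frame. *)
Fixpoint Ck (k : nat) f : Prop :=
  (forall x, U x -> differentiable f x) /\
  (if k is k'.+1 then forall i, Ck k' ('D_(e i) f) else True).

Lemma Ck_diff k f x : U x -> Ck k f -> differentiable f x.
Proof. by move=> Ux; case: k => [|k] [df _]; exact: df. Qed.

Lemma CkW k f : Ck k.+1 f -> Ck k f.
Proof.
elim: k f => [|k IH] f [df Hf]; first by split.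
by split=> // i; apply: IH; exact: Hf.
Qed.

Lemma Ck_eq k f h : (forall x, U x -> f x = h x) -> Ck k f -> Ck k h.
Proof.
elim: k f h => [|k IH] f h fh [df Hf]; split=> //.
- by move=> x Ux; have [] := hasD_on (v := 0) oU Ux fh (conj (df _ Ux) erefl).
- by move=> x Ux; have [] := hasD_on (v := 0) oU Ux fh (conj (df _ Ux) erefl).
move=> i; apply: IH (Hf i) => x Ux.
by have [_ ->] := hasD_on (v := e i) oU Ux fh (conj (df _ Ux) erefl).
Qed.

(** The derivatives need only be known on U; this is how Ck is established in
    practice. *)
Lemma CkS k f (df : J -> V -> R) :
  (forall i x, U x -> hasD (e i) f x (df i x)) ->
  (forall x, U x -> differentiable f x) ->
  (forall i, Ck k (df i)) -> Ck k.+1 f.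
Proof.
move=> fdf dfx Hdf; split=> // i; apply: Ck_eq (Hdf i) => x Ux.
by have [_ ->] := fdf i x Ux.
Qed.

Lemma Ck_cst k (c : R) : Ck k (fun=> c).
Proof.
elim: k c => [|k IH] c; first by split=> // x _; exact: differentiable_cst.
apply: (CkS (df := fun _ _ => 0)) => [i x _|x _|i].
- exact: hasD_cst.
- exact: differentiable_cst.
- exact: IH.
Qed.

Lemma CkD k f h : Ck k f -> Ck k h -> Ck k (fun x => f x + h x).
Proof.
have D2 (a b : V -> R) x : differentiable a x -> differentiable b x ->
  differentiable (fun y => a y + b y) x by exact: differentiableD.
elim: k f h => [|k IH] f h [df Hf] [dh Hh].
  by split=> // x Ux; apply: D2; auto.
apply: (CkS (df := fun i x => 'D_(e i) f x + 'D_(e i) h x)).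
- by move=> i x Ux; apply: hasD_D; split; auto.
- by move=> x Ux; apply: D2; auto.
- by move=> i; apply: IH; [exact: Hf|exact: Hh].
Qed.

Lemma CkM k f h : Ck k f -> Ck k h -> Ck k (fun x => f x * h x).
Proof.
have M2 (a b : V -> R) x : differentiable a x -> differentiable b x ->
  differentiable (fun y => a y * b y) x by exact: differentiableM.
elim: k f h => [|k IH] f h Hf Hh.
  by split=> // x Ux; apply: M2; [exact: Ck_diff Ux Hf|exact: Ck_diff Ux Hh].
apply: (CkS (df := fun i x => 'D_(e i) f x * h x + f x * 'D_(e i) h x)).
- by move=> i x Ux; apply: hasD_M; split=> //; [exact: Ck_diff Ux Hf|exact: Ck_diff Ux Hh].
- by move=> x Ux; apply: M2; [exact: Ck_diff Ux Hf|exact: Ck_diff Ux Hh].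
- move=> i; apply: CkD; apply: IH; try exact: CkW.
    by case: Hf => _ /(_ i).
  by case: Hh => _ /(_ i).
Qed.

Lemma CkX k f m : Ck k f -> Ck k (fun x => f x ^+ m).
Proof.
move=> Hf; elim: m => [|m IH]; first exact: Ck_cst.
by apply: Ck_eq (CkM Hf IH) => x _; rewrite exprS.
Qed.

Lemma CkV k f : (forall x, U x -> f x != 0) -> Ck k f ->
  Ck k (fun x => (f x)^-1).
Proof.
move=> f0; elim: k f f0 => [|k IH] f f0 Hf.
  by split=> // x Ux; apply: differentiableV; [exact: Ck_diff Ux Hf|exact: f0].
apply: (CkS (df := fun i x => - 1 * 'D_(e i) f x * (f x)^-1 ^+ 2)).
- move=> i x Ux; apply: hasD_eq.
    by apply: hasD_V; [exact: f0|split; [exact: Ck_diff Ux Hf|reflexivity]].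
  by rewrite exprVn mulN1r.
- by move=> x Ux; apply: differentiableV; [exact: Ck_diff Ux Hf|exact: f0].
- move=> i; apply: CkM; first by apply: CkM; [exact: Ck_cst|case: Hf => _ /(_ i)].
  by apply: CkX; apply: IH => //; exact: CkW.
Qed.

(** Bootstrap: f' = f th gains one order of smoothness from f itself. It spares
    the treatment of real powers, which solve such an equation. *)
Lemma Ck_ode k f (th : J -> V -> R) : (forall x, U x -> differentiable f x) ->
  (forall i x, U x -> hasD (e i) f x (f x * th i x)) ->
  (forall i k, Ck k (th i)) -> Ck k f.
Proof.
move=> df Df Hth; elim: k => [|k IH]; first by split.
by apply: CkS Df df _ => i; apply: CkM.
Qed.

End Smoothness.

Lemma Ck_comp {R : realType} {V : normedModType R} {J : Type} (e : J -> V)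
    (U : set V) (I : set R) (h : V -> R) (f : R -> R) k :
  open U -> (forall x, U x -> I (h x)) -> (forall k, Ck e U k h) ->
  Ck (fun _ : unit => 1 : R) I k f -> Ck e U k (fun x => f (h x)).
Proof.
move=> oU UI Hh; elim: k f => [|k IH] f Hf.
  split=> // x Ux; apply: differentiable_comp (Ck_diff Ux (Hh 0%N)) _.
  exact: Ck_diff (UI _ Ux) Hf.
apply: (CkS oU (df := fun i x => 'D_1 f (h x) * 'D_(e i) h x)).
- move=> i x Ux; apply: hasD_comp; split=> //.
    exact: Ck_diff (UI _ Ux) Hf.
  exact: Ck_diff Ux (Hh 0%N).
- move=> x Ux; apply: differentiable_comp (Ck_diff Ux (Hh 0%N)) _.
  exact: Ck_diff (UI _ Ux) Hf.
- move=> i; apply: CkM => //; first by apply: (IH ('D_1 f)); case: Hf => _ /(_ tt).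
  by case: (Hh k.+1) => _ /(_ i).
Qed.

Definition frame {R : realType} {m} (a : 'I_m) : 'rV[R]_m := delta_mx 0 a.

Lemma smooth_on_Ck {R : realType} {m} (U : set 'rV[R]_m) f :
  smooth_on U f <-> forall k, Ck frame U k f.
Proof.
split=> [Hf k|Hf s].
  elim: k f Hf => [|k IH] f Hf; split=> //; try by move=> x Ux; exact: (Hf [::]).
  move=> i.
  by apply: IH => s x Ux; have := Hf (rcons s i) x Ux; rewrite foldr_rcons.
elim/last_ind: s f Hf => [|s a IH] f Hf p Up; first exact: Ck_diff Up (Hf 0%N).
rewrite foldr_rcons; apply: IH => // k.
by case: (Hf k.+1) => _ /(_ a).
Qed.

Lemma smooth1_on_Ck {R : realType} (I : set R) f :
  smooth1_on I f <-> forall k, Ck (fun _ : unit => 1 : R) I k f.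
Proof.
have DE (f' : R -> R) : 'D_1 f' = derive1 f'.
  by apply/funext => t; rewrite derive1E.
split=> [Hf k|Hf k].
  elim: k f Hf => [|k IH] f Hf; split=> //; try by move=> x Ix; exact/derivable1_diffP/(Hf 0%N).
  case.
  by rewrite DE; apply: IH => j t It; rewrite -derive1Sn; exact: Hf.
elim: k f Hf => [|k IH] f Hf t It.
  by apply/derivable1_diffP; exact: Ck_diff It (Hf 0%N).
rewrite derive1Sn; apply: IH => // j; rewrite -DE.
by case: (Hf j.+1) => _ /(_ tt).
Qed.

(** * Traces of the Ricci tensor under a conformal change: the algebra *)

(** Contraction with a Kronecker symbol; indices are then renamed instead of
    splitting sums. *)
Lemma sum_deltal {R : comNzRingType} {m} (l : 'I_m) (F : 'I_m -> R) :
  \sum_j (l == j)%:R * F j = F l.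
Proof.
rewrite (bigD1 l)//= eqxx mul1r big1 ?addr0// => j /negbTE.
by rewrite eq_sym => ->; rewrite mul0r.
Qed.

Lemma sum_deltar {R : comNzRingType} {m} (l : 'I_m) (F : 'I_m -> R) :
  \sum_j (j == l)%:R * F j = F l.
Proof. by rewrite -[RHS]sum_deltal; apply: eq_bigr => j _; rewrite eq_sym. Qed.

Section ConformalChange.
Context {R : realFieldType} {m : nat}.
Implicit Types (G Gi T : 'I_m -> 'I_m -> R) (u w : 'I_m -> R).
Implicit Types (A B : 'I_m -> 'I_m -> 'I_m -> R).

(** g^jk T_jk *)
Definition contract Gi T : R := \sum_j \sum_k Gi j k * T j k.

Lemma eq_contract Gi T T' : (forall j k, T j k = T' j k) ->
  contract Gi T = contract Gi T'.
Proof. by move=> TT'; do 2![apply: eq_bigr => ? _]; rewrite TT'. Qed.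

Lemma contractD Gi T T' :
  contract Gi (fun j k => T j k + T' j k) = contract Gi T + contract Gi T'.
Proof.
rewrite /contract -big_split; apply: eq_bigr => j _.
by rewrite -big_split; apply: eq_bigr => k _; rewrite /= mulrDr.
Qed.

Lemma contractZ Gi T (c : R) :
  contract Gi (fun j k => c * T j k) = c * contract Gi T.
Proof.
rewrite /contract big_distrr; apply: eq_bigr => j _ /=.
by rewrite big_distrr; apply: eq_bigr => k _ /=; ring.
Qed.

Lemma contractN Gi T : contract Gi (fun j k => - T j k) = - contract Gi T.
Proof.
rewrite -mulN1r -contractZ; apply: eq_contract => j k.
by rewrite mulN1r.
Qed.

Lemma contractB Gi T T' :
  contract Gi (fun j k => T j k - T' j k) = contract Gi T - contract Gi T'.
Proof. by rewrite contractD contractN. Qed.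

Lemma contract_sum Gi (S : 'I_m -> 'I_m -> 'I_m -> R) :
  contract Gi (fun j k => \sum_i S i j k) = \sum_i contract Gi (S i).
Proof.
rewrite /contract [RHS]exchange_big; apply: eq_bigr => j _ /=.
by rewrite [RHS]exchange_big; apply: eq_bigr => k _; rewrite big_distrr.
Qed.

Lemma contract_tr Gi T : (forall j k, Gi j k = Gi k j) ->
  contract Gi (fun j k => T k j) = contract Gi T.
Proof.
move=> Gis; rewrite /contract exchange_big.
by do 2![apply: eq_bigr => ? _]; rewrite Gis.
Qed.

(** A^r_ik B^i_jr, the polarisation of the last term of the Ricci tensor. *)
Definition quad A B (j k : 'I_m) : R := \sum_i \sum_r A r i k * B i j r.

Lemma quadDl A A' B j k :
  quad (fun l j k => A l j k + A' l j k) B j k = quad A B j k + quad A' B j k.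
Proof.
rewrite /quad -big_split; apply: eq_bigr => i _; rewrite -big_split.
by apply: eq_bigr => r _; rewrite /= mulrDl.
Qed.

Lemma quadDr A B B' j k :
  quad A (fun l j k => B l j k + B' l j k) j k = quad A B j k + quad A B' j k.
Proof.
rewrite /quad -big_split; apply: eq_bigr => i _; rewrite -big_split.
by apply: eq_bigr => r _; rewrite /= mulrDr.
Qed.

Context (G Gi : 'I_m -> 'I_m -> R) (u w : 'I_m -> R).
Hypothesis Gs : forall j k, G j k = G k j.
Hypothesis Gis : forall j k, Gi j k = Gi k j.
Hypothesis GiG : forall j l, \sum_k Gi j k * G k l = (j == l)%:R.
Hypothesis Gw : forall k, \sum_i G k i * w i = u k.

Lemma raise_index l : \sum_k Gi l k * u k = w l.
Proof.
transitivity (\sum_k \sum_i (Gi l k * G k i) * w i).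
  apply: eq_bigr => k _; rewrite -Gw big_distrr; apply: eq_bigr => i _.
  by rewrite /= mulrA.
rewrite exchange_big -[RHS]sum_deltal; apply: eq_bigr => i _ /=.
by rewrite -GiG big_distrl.
Qed.

Lemma contract_G : contract Gi G = m%:R.
Proof.
rewrite /contract (eq_bigr (fun=> 1)); first by rewrite sumr_const card_ord.
by move=> j _; under eq_bigr do rewrite Gs; rewrite GiG eqxx.
Qed.

(** The difference of the Levi-Civita connections of exp(2 f) g and g, where
    u = df and w is its g-gradient. *)
Definition corr (l j k : 'I_m) : R :=
  (l == j)%:R * u k + (l == k)%:R * u j - G j k * w l.

Lemma corr_sym l j k : corr l j k = corr l k j.
Proof. by rewrite /corr (Gs k) (addrC (_ * u j)). Qed.

Lemma contract_corr l : contract Gi (corr l) = (2 - m%:R) * w l.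
Proof.
rewrite /corr contractB contractD.
have -> : contract Gi (fun j k => G j k * w l) = w l * m%:R.
  by rewrite -contract_G -contractZ; apply: eq_contract => j k; rewrite mulrC.
have E : contract Gi (fun j k => (l == j)%:R * u k) = w l.
  rewrite /contract -raise_index -(sum_deltal l (fun j => \sum_k Gi j k * u k)).
  by apply: eq_bigr => j _; rewrite big_distrr; apply: eq_bigr => k _ /=; ring.
have E2 : contract Gi (fun j k => (l == k)%:R * u j) = w l.
  by rewrite (contract_tr (fun k j => (l == k)%:R * u j)).
by rewrite E E2; ring.
Qed.

Lemma trace_corr k : \sum_i corr i i k = m%:R * u k.
Proof.
rewrite /corr sumrB big_split/=.
under eq_bigr do rewrite eqxx mul1r.
rewrite sumr_const card_ord sum_deltar.
by under [X in _ - X]eq_bigr do rewrite Gs; rewrite Gw addrK mulr_natl.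
Qed.

(** Expanding corr gives three terms. Those coming from delta^i_r u_j and from
    g_jr w^i both equal w^k A^i_ik after contraction and cancel, which leaves the
    g-trace of A. *)
Lemma contract_quad_corr A : (forall l j k, A l j k = A l k j) ->
  contract Gi (quad A corr) = \sum_r u r * contract Gi (A r).
Proof.
move=> As.
have E j k : quad A corr j k = \sum_r u r * A r j k
    + u j * (\sum_i A i i k) - \sum_i \sum_r A r i k * G j r * w i.
  rewrite /quad; transitivity (\sum_i (((i == j)%:R * (\sum_r u r * A r i k)
    + u j * A i i k) - \sum_r A r i k * G j r * w i)).
    apply: eq_bigr => i _; rewrite -[in u j * _](sum_deltal i (fun r => A r i k)).
    rewrite !big_distrr -big_split -sumrB; apply: eq_bigr => r _ /=.
    by rewrite /corr; ring.
  by rewrite sumrB big_split/= sum_deltar -big_distrr.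
rewrite (eq_contract _ E) contractB contractD.
have -> : contract Gi (fun j k => \sum_r u r * A r j k) =
    \sum_r u r * contract Gi (A r).
  by rewrite contract_sum; apply: eq_bigr => r _; rewrite contractZ.
suff -> : contract Gi (fun j k => u j * (\sum_i A i i k)) =
    contract Gi (fun j k => \sum_i \sum_r A r i k * G j r * w i).
  by rewrite addrK.
transitivity (\sum_k w k * \sum_i A i i k).
  rewrite -(contract_tr _ Gis) /contract; apply: eq_bigr => k _.
  rewrite -raise_index big_distrl; apply: eq_bigr => j _ /=; ring.
rewrite contract_sum; apply: eq_bigr => i _.
rewrite contract_sum big_distrr; apply: eq_bigr => r _ /=.
rewrite /contract exchange_big/=.
transitivity (\sum_k w i * ((r == k)%:R * A r i k)).
  by rewrite -big_distrr sum_deltal/= As.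
apply: eq_bigr => k _; rewrite eq_sym -GiG big_distrl big_distrr.
by apply: eq_bigr => j _ /=; rewrite (Gis k) (Gs j); ring.
Qed.

Lemma contract_quadC A B : (forall l j k, A l j k = A l k j) ->
  (forall l j k, B l j k = B l k j) ->
  contract Gi (quad A B) = contract Gi (quad B A).
Proof.
move=> As Bs; rewrite -(contract_tr _ Gis); apply: eq_contract => j k.
rewrite /quad exchange_big; apply: eq_bigr => i _; apply: eq_bigr => r _.
by rewrite As Bs mulrC.
Qed.

End ConformalChange.


Section ConformalScalar.
Context {R : realFieldType} {m : nat}.
Context (G Gi : 'I_m -> 'I_m -> R) (u w : 'I_m -> R).
Hypothesis Gs : forall j k, G j k = G k j.
Hypothesis Gis : forall j k, Gi j k = Gi k j.
Hypothesis GiG : forall j l, \sum_k Gi j k * G k l = (j == l)%:R.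
Hypothesis Gw : forall k, \sum_i G k i * w i = u k.
Context (Gam dGam dG : 'I_m -> 'I_m -> 'I_m -> R) (du df : 'I_m -> 'I_m -> R).
Context (f dw : 'I_m -> R).
Hypothesis Gam_sym : forall l j k, Gam l j k = Gam l k j.
Hypothesis cGam : forall l, contract Gi (Gam l) = 0.
Hypothesis cdGam : forall i, contract Gi (dGam i) = 0.
Hypothesis cquad : contract Gi (quad Gam Gam) = 0.
Hypothesis cdG : forall i, contract Gi (dG i) = 2 * f i.

Let Gam' l j k := Gam l j k + corr G u w l j k.

(** By contract_quad_corr the mixed terms are multiples of the g-trace of Gamma,
    which vanishes for a Kahler metric. *)
Lemma contract_quad_conformal :
  contract Gi (quad Gam' Gam') = (2 - m%:R) * \sum_i u i * w i.
Proof.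
have cs l j k : corr G u w l j k = corr G u w l k j by exact: corr_sym.
rewrite (@eq_contract _ _ _ _ (fun j k => (quad Gam Gam j k
    + quad Gam (corr G u w) j k) + (quad (corr G u w) Gam j k
    + quad (corr G u w) (corr G u w) j k))); last first.
  by move=> j k; rewrite quadDl !quadDr.
rewrite !contractD cquad add0r.
rewrite -(contract_quadC Gis Gam_sym cs).
rewrite !(contract_quad_corr Gs Gis GiG Gw)// [X in X + (X + _)]big1; last first.
  by move=> r _; rewrite cGam mulr0.
rewrite !add0r big_distrr; apply: eq_bigr => r _ /=.
by rewrite (contract_corr Gs Gis GiG Gw); ring.
Qed.

(** The scalar curvature of a conformal change, up to the factor. The arrays
    dGam i j k, dG i j k, df, du and dw i stand for d_i Gamma^i_jk, d_i g_jk,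
    d_j f_k, d_j u_k and d_i w^i; f is the trace of Gamma. The hypotheses
    cGam, cdGam, cquad are what the Kahler condition provides. *)
Lemma contract_conformal_ricci :
  contract Gi (fun j k =>
    \sum_i (dGam i j k + ((i == j)%:R * du i k + (i == k)%:R * du i j
            - (dG i j k * w i + G j k * dw i)))
    - (df j k + m%:R * du j k)
    + \sum_r Gam' r j k * (f r + m%:R * u r)
    - quad Gam' Gam' j k)
  = - contract Gi df + (2 - m%:R) * contract Gi du
    - m%:R * (\sum_i f i * w i) - m%:R * (\sum_i dw i)
    + (2 - m%:R) * (m%:R - 1) * \sum_i u i * w i.
Proof.
rewrite contractB contractD contractB contractD contractZ.
rewrite contract_quad_conformal !contract_sum.
have -> : \sum_r contract Gi (fun j k => Gam' r j k * (f r + m%:R * u r)) =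
    (2 - m%:R) * (\sum_r f r * w r) + (2 - m%:R) * m%:R * \sum_r u r * w r.
  rewrite !big_distrr -big_split; apply: eq_bigr => r _ /=.
  rewrite (@eq_contract _ _ _ _ (fun j k => (f r + m%:R * u r) * Gam' r j k)); last first.
    by move=> j k; rewrite mulrC.
  rewrite contractZ contractD cGam add0r (contract_corr Gs Gis GiG Gw); ring.
have -> : \sum_i contract Gi (fun j k => dGam i j k + ((i == j)%:R * du i k
      + (i == k)%:R * du i j - (dG i j k * w i + G j k * dw i))) =
    2 * contract Gi du - 2 * (\sum_i f i * w i) - m%:R * \sum_i dw i.
  have E1 : \sum_i contract Gi (fun j k => (i == j)%:R * du i k) = contract Gi du.
    rewrite -contract_sum; apply: eq_contract => j k.
    by rewrite (sum_deltar j (fun i => du i k)).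
  have E2 : \sum_i contract Gi (fun j k => (i == k)%:R * du i j) = contract Gi du.
    rewrite -contract_sum -(contract_tr du Gis); apply: eq_contract => j k.
    by rewrite (sum_deltar k (fun i => du i j)).
  transitivity (\sum_i (contract Gi (fun j k => (i == j)%:R * du i k) +
     contract Gi (fun j k => (i == k)%:R * du i j)
     - (2 * (f i * w i) + m%:R * dw i))).
    apply: eq_bigr => i _.
    rewrite contractD cdGam add0r contractB !contractD; congr (_ - (_ + _)).
      rewrite (@eq_contract _ _ _ _ (fun j k => w i * dG i j k)); last first.
        by move=> j k; rewrite mulrC.
      by rewrite contractZ cdG; ring.
    rewrite (@eq_contract _ _ _ _ (fun j k => dw i * G j k)); last first.
      by move=> j k; rewrite mulrC.
    by rewrite contractZ (contract_G Gs GiG); ring.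
  by rewrite sumrB !big_split/= E1 E2 -!big_distrr/=; ring.
ring.
Qed.

End ConformalScalar.

Section ComplexStructure.
Context {R : realFieldType} {m : nat}.
Context (s : 'I_m -> 'I_m) (e : 'I_m -> R) (Gi : 'I_m -> 'I_m -> R).
Hypothesis ss : involutive s.
Hypothesis ee : forall a, e a * e a = 1.
Hypothesis es : forall a, e (s a) = - e a.
Hypothesis GiJ : forall j k, Gi (s j) (s k) = e j * e k * Gi j k.

(** J-antisymmetric tensors have no trace with respect to a J-invariant one:
    reindexing both sums by the involution s changes the sign. *)
Lemma contract_J0 T : (forall j k, T (s j) (s k) = - (e j * e k * T j k)) ->
  contract Gi T = 0.
Proof.
move=> TJ; suff : contract Gi T = - contract Gi T by move=> H; lra.
rewrite -contractN /contract (reindex_inj (inv_inj ss)).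
apply: eq_bigr => j _; rewrite (reindex_inj (inv_inj ss)).
apply: eq_bigr => k _; rewrite GiJ TJ.
by rewrite -[in RHS](mul1r (Gi j k)) -[in RHS](ee j) -[X in X * e j](mulr1) -(ee k); ring.
Qed.

Context (Gam : 'I_m -> 'I_m -> 'I_m -> R).
Hypothesis Gam_sym : forall l j k, Gam l j k = Gam l k j.
Hypothesis GamJ : forall l j k, Gam (s l) j (s k) = e l * e k * Gam l j k.

(** Complex bilinearity: Gamma(JX, JY) = J J Gamma(X, Y). *)
Lemma Gam_anti l j k : Gam l (s j) (s k) = - (e j * e k * Gam l j k).
Proof.
rewrite -{1}(ss l) GamJ Gam_sym -{1}(ss (s l)) GamJ ss Gam_sym es.
transitivity (- (e l * e l * (e j * e k * Gam l j k))); first by ring.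
by rewrite ee mul1r.
Qed.

Lemma contract_Gam0 l : contract Gi (Gam l) = 0.
Proof. by apply: contract_J0 => j k; exact: Gam_anti. Qed.

(** The two factors contribute J twice: once through the lower index k, once
    through j, while the summed index r contributes a square of a sign. *)
Lemma contract_quad_Gam0 : contract Gi (quad Gam Gam) = 0.
Proof.
apply: contract_J0 => j k.
rewrite /quad -mulNr big_distrr; apply: eq_bigr => i _ /=.
rewrite big_distrr (reindex_inj (inv_inj ss)); apply: eq_bigr => r _ /=.
rewrite GamJ Gam_anti.
transitivity (- (e r * e r * (e j * e k * (Gam r i k * Gam i j r)))); first by ring.
by rewrite ee; ring.
Qed.

End ComplexStructure.

(** * Rank-one perturbations of scalar matrices; the complex structure in coordinates *)

(** Evaluate the determinant of the block matrix with rows (1, - v) and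
    (u, a) in two ways, by eliminating either diagonal block. *)
Lemma det_rank1 {F : fieldType} {n} (a : F) (u : 'cV[F]_n) (v : 'rV[F]_n) :
  (0 < n)%N -> a != 0 ->
  \det (a%:M + u *m v) = a ^+ n.-1 * (a + (v *m u) 0 0).
Proof.
move=> n0 a0.
pose B := block_mx (1%:M : 'M[F]_1) (- v) u (a%:M).
have E1 : B = block_mx 1%:M 0 u 1%:M *m block_mx 1%:M (- v) 0 (a%:M + u *m v).
  rewrite mulmx_block !mul1mx !mul0mx ?mulmx0 !mulmx1 ?addr0 ?add0r mulmxN.
  by rewrite addrCA addNr addr0.
have E2 : B = block_mx 1%:M (- (a^-1 *: v)) 0 1%:M *m
     block_mx (1%:M + a^-1 *: (v *m u)) 0 u (a%:M).
  rewrite mulmx_block !mul1mx !mul0mx ?mulmx0 ?add0r ?addr0 mulNmx mul_mx_scalar.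
  by rewrite -scalemxAl addrK scalerN scalerA divff// scale1r.
have : \det B = \det B by [].
rewrite {1}E1 E2 !det_mulmx !det_ublock !det_lblock !det1 !mul1r det_scalar.
move=> ->; rewrite det_mx11 !mxE eqxx mulr1n.
by case: n n0 u v B E1 E2 => // n _ u v _ _ _; rewrite exprS/=; field.
Qed.

(** N / r is idempotent, so a + b N acts as a on its kernel and as a + r b on its
    image. *)
Lemma idempotent_inverse {F : fieldType} {n} (N : 'M[F]_n) (a b r : F) :
  a != 0 -> a + r * b != 0 -> N *m N = r *: N ->
  (a^-1 *: (1%:M - (b / (a + r * b)) *: N)) *m (a%:M + b *: N) = 1%:M.
Proof.
move=> a0 ab0 NN.
rewrite -scalemxAl mulmxBl mul1mx mulmxDr -!scalemxAl -scalemxAr NN mul_mx_scalar.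
set c := b / _; rewrite -scalerDr.
have -> : a%:M + b *: N - c *: (a *: N + b *: (r *: N)) = a%:M.
  rewrite !scalerA -scalerDl scalerA -addrA -scalerBl.
  suff -> : b - c * (a + b * r) = 0 by rewrite scale0r addr0.
  by rewrite (mulrC b r) divfK// subrr.
by rewrite scale_scalar_mx mulVf.
Qed.

Lemma trace_idempotent {F : fieldType} {n} (N : 'M[F]_n) (d x y r : F) :
  N *m N = r *: N -> \tr N = r ->
  \tr ((1%:M - d *: N) *m (x%:M + y *: N)) =
  x * (n%:R - d * r) + y * (r * (1 - d * r)).
Proof.
move=> NN trN; rewrite mulmxBl mul1mx mulmxDr -!scalemxAl -scalemxAr NN mul_mx_scalar.
rewrite linearB /= linearD /= linearZ /= linearD /= !linearZ /= trN.
by rewrite mxtrace_scalar -mulr_natr; ring.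
Qed.

Lemma mulmx1_invmx {F : fieldType} {n} (A B : 'M[F]_n) :
  A *m B = 1%:M -> invmx B = A.
Proof.
move=> AB; have [_ Bu] := mulmx1_unit AB.
by rewrite -[LHS]mul1mx -AB -mulmxA mulmxV// mulmx1.
Qed.

Section Coordinates.
Context {R : realType} {n : nat}.
Local Notation I2 := 'I_(n + n).
Local Notation pt := 'rV[R]_(n + n).

(** J0 is encoded by an involution of the indices and a sign, so that
    J-invariance of a tensor is an identity between single components and sums
    over J0 become reindexings. *)
Definition jswap (a : I2) : I2 :=
  match fintype.split a with inl i => rshift n i | inr i => lshift n i end.
Definition jsign (a : I2) : R :=
  match fintype.split a with inl _ => 1 | inr _ => - 1 end.

Lemma splitl (i : 'I_n) : fintype.split (lshift n i) = inl i.
Proof. exact: (unsplitK (inl i)). Qed.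
Lemma splitr (i : 'I_n) : fintype.split (rshift n i) = inr i.
Proof. exact: (unsplitK (inr i)). Qed.
Lemma jswapl i : jswap (lshift n i) = rshift n i.
Proof. by rewrite /jswap splitl. Qed.
Lemma jswapr i : jswap (rshift n i) = lshift n i.
Proof. by rewrite /jswap splitr. Qed.
Lemma jsignl i : jsign (lshift n i) = 1.
Proof. by rewrite /jsign splitl. Qed.
Lemma jsignr i : jsign (rshift n i) = - 1.
Proof. by rewrite /jsign splitr. Qed.

Variant lr_spec (a : I2) : I2 -> Type :=
| LrL i of a = lshift n i : lr_spec a (lshift n i)
| LrR i of a = rshift n i : lr_spec a (rshift n i).

Lemma lrP a : lr_spec a a.
Proof.
by rewrite -{2}[a]splitK; case E: (fintype.split a) => [i|i] /=; constructor;
  rewrite -[a]splitK E.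
Qed.

Lemma jswapK : involutive jswap.
Proof. by move=> a; case: (lrP a) => i _; rewrite ?(jswapl, jswapr). Qed.

Lemma jsign2 a : jsign a * jsign a = 1.
Proof. by case: (lrP a) => i _; rewrite ?(jsignl, jsignr); ring. Qed.

Lemma jsign_neq0 a : jsign a != 0.
Proof. by case: (lrP a) => i _; rewrite ?(jsignl, jsignr) ?oppr_eq0 oner_neq0. Qed.

Lemma jsign_swap a : jsign (jswap a) = - jsign a.
Proof.
by case: (lrP a) => i _; rewrite ?(jswapl, jswapr, jsignl, jsignr) ?opprK.
Qed.

Lemma J0E a b : J0 a b = jsign a * (jswap a == b)%:R :> R.
Proof.
rewrite /J0; case: (lrP a) => i _; case: (lrP b) => j _;
  rewrite ?(jswapl, jswapr, jsignl, jsignr) ?(block_mxEul, block_mxEur, block_mxEdl, block_mxEdr) !mxE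
   ?eq_lshift ?eq_rshift ?eq_lrshift ?eq_rlshift ?mul1r ?mulN1r ?oppr0//.
Qed.

Lemma mulJ0E (A : 'M[R]_(n + n)) a b : (J0 *m A) a b = jsign a * A (jswap a) b.
Proof.
rewrite mxE -[A _ b](sum_deltal (jswap a) (fun c => A c b)) big_distrr.
by apply: eq_bigr => c _; rewrite J0E -mulrA.
Qed.

Lemma radialE (p : pt) : radial p = \sum_a p 0 a * p 0 a.
Proof. by rewrite big_split_ord /= /radial big_split/=; congr (_ + _); apply: eq_bigr. Qed.

(** p^T p + (p J0)^T (p J0): r times the orthogonal projection onto the complex
    line through p. *)
Definition cline_mx (p : pt) : 'M[R]_(n + n) :=
  \matrix_(a, b) (p 0 a * p 0 b + jsign a * jsign b * (p 0 (jswap a) * p 0 (jswap b))).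

Lemma cline_mx_sym p a b : cline_mx p a b = cline_mx p b a.
Proof. by rewrite !mxE; ring. Qed.

Lemma cline_mxJ p a b : cline_mx p (jswap a) (jswap b) = jsign a * jsign b * cline_mx p a b.
Proof.
rewrite !mxE !jswapK !jsign_swap.
transitivity ((jsign a * jsign a) * (jsign b * jsign b) * (p 0 (jswap a) * p 0 (jswap b)) +
  jsign a * jsign b * (p 0 a * p 0 b)); first by rewrite !jsign2; ring.
ring.
Qed.

Lemma sum_swap (F : I2 -> R) : \sum_a F (jswap a) = \sum_a F a.
Proof. by rewrite [RHS](reindex_inj (inv_inj jswapK)). Qed.

(** p and its image under J0 are orthogonal. *)
Lemma sum_p_Jp (p : pt) : \sum_a jsign a * p 0 a * p 0 (jswap a) = 0.
Proof.
set S := LHS; suff : S = - S by move=> H; lra.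
rewrite /S -{1}sum_swap -sumrN; apply: eq_bigr => a _.
by rewrite jsign_swap jswapK; ring.
Qed.

Lemma sum_Jp_Jp (p : pt) :
  \sum_a (jsign a * p 0 (jswap a)) * (jsign a * p 0 (jswap a)) = radial p.
Proof.
rewrite radialE -sum_swap; apply: eq_bigr => a _.
by rewrite jswapK jsign_swap -[RHS]mul1r -(jsign2 a); ring.
Qed.

Lemma cline_mx_p p a : \sum_b cline_mx p a b * p 0 b = radial p * p 0 a.
Proof.
transitivity (p 0 a * (\sum_b p 0 b * p 0 b) +
   jsign a * p 0 (jswap a) * (\sum_b jsign b * p 0 b * p 0 (jswap b))).
  by rewrite !big_distrr -big_split; apply: eq_bigr => b _; rewrite /= mxE; ring.
by rewrite sum_p_Jp -radialE; ring.
Qed.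

Lemma cline_mx2 p : cline_mx p *m cline_mx p = radial p *: cline_mx p.
Proof.
apply/matrixP => a c; rewrite mxE.
transitivity (p 0 c * (\sum_b cline_mx p a b * p 0 b) +
  jsign c * p 0 (jswap c) * (\sum_b cline_mx p a b * (jsign b * p 0 (jswap b)))).
  rewrite !big_distrr -big_split; apply: eq_bigr => b _ /=.
  by rewrite [cline_mx p b c]mxE; ring.
have -> : \sum_b cline_mx p a b * (jsign b * p 0 (jswap b)) =
    radial p * (jsign a * p 0 (jswap a)).
  transitivity (p 0 a * (\sum_b jsign b * p 0 b * p 0 (jswap b)) +
     jsign a * p 0 (jswap a) * (\sum_a (jsign a * p 0 (jswap a)) * (jsign a * p 0 (jswap a)))).
    by rewrite !big_distrr -big_split; apply: eq_bigr => b _; rewrite /= mxE; ring.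
  by rewrite sum_p_Jp sum_Jp_Jp; ring.
by rewrite cline_mx_p !mxE; ring.
Qed.

Lemma cline_mx_tr p : \sum_a cline_mx p a a = 2 * radial p.
Proof.
rewrite mulr_natl mulr2n -{2}sum_Jp_Jp radialE -big_split.
by apply: eq_bigr => a _; rewrite mxE /=; ring.
Qed.

End Coordinates.

(** * Radial functions *)

Lemma hasD_coord {R : realType} {m} (a b : 'I_m) (p : 'rV[R]_m) :
  hasD (frame a) (fun q : 'rV[R]_m => q 0 b) p (a == b)%:R.
Proof.
have @f : {linear 'rV[R]_m -> R}.
  by exists (fun q : 'rV[R]_m => q 0 b); do 2![eexists]; do ?[constructor];
     rewrite ?mxE// => ? *; rewrite ?mxE//; move=> ?; rewrite !mxE.
split; first exact: differentiable_coord.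
rewrite deriveE; last exact: differentiable_coord.
rewrite (_ : (fun q : 'rV[R]_m => q 0 b) = f)// diff_lin; last exact: coord_continuous.
by rewrite /f /= mxE eqxx /= eq_sym.
Qed.

Section RadialCalculus.
Context {R : realType} {n : nat}.
Local Notation I2 := 'I_(n + n).
Local Notation pt := 'rV[R]_(n + n).
Implicit Types (p q : pt) (a b c : I2).

Lemma hasD_radial a p : hasD (frame a) (@radial R n) p (2 * p 0 a).
Proof.
apply: (@hasD_ext _ _ _ (fun q => \sum_b q 0 b * q 0 b)) => [q|].
  by rewrite radialE.
apply: hasD_eq.
  by apply: hasD_sum => b; apply: hasD_M; exact: hasD_coord.
rewrite big_split/= sum_deltal mulr_natl mulr2n; congr (_ + _).
by rewrite -[RHS](sum_deltal a (fun b => p 0 b)); apply: eq_bigr => b _; rewrite mulrC.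
Qed.

Lemma differentiable_radial p : differentiable (@radial R n) p.
Proof.
rewrite (_ : @radial R n = \sum_b (fun q : pt => q 0 b * q 0 b)).
  by apply: differentiable_sum => b; apply: differentiableM; exact: differentiable_coord.
by apply/funext => q; rewrite radialE fct_sumE.
Qed.

Lemma continuous_radial : continuous (@radial R n).
Proof.
by move=> p; apply: differentiable_continuous; exact: differentiable_radial.
Qed.

Lemma open_oint (al : R) (be : \bar R) : open (oint al be).
Proof.
rewrite (_ : oint al be = [set t | al < t] `&` [set t | (t%:E < be)%E])//.
by apply: openI; [exact: open_gt|exact: open_ereal_lt].
Qed.

Lemma open_annulus (al : R) (be : \bar R) : open (annulus n al be).
Proof.
apply: open_comp; last exact: open_oint.
by move=> p _; exact: continuous_radial.
Qed.

Context (f f1 : R -> R) (I : set R).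
Hypothesis df : forall t, I t -> hasD (1 : R) f t (f1 t).

Lemma hasD_comp_radial a p : I (radial p) ->
  hasD (frame a) (fun q => f (radial q)) p (2 * p 0 a * f1 (radial p)).
Proof.
move=> Ip; apply: hasD_eq (hasD_comp (df Ip) (hasD_radial a p)) _.
by rewrite mulrC.
Qed.

Lemma hasD_radial_coord a b p : I (radial p) ->
  hasD (frame a) (fun q => f (radial q) * q 0 b) p
    (2 * p 0 a * p 0 b * f1 (radial p) + (a == b)%:R * f (radial p)).
Proof.
move=> Ip; apply: hasD_eq.
  by apply: hasD_M; [exact: hasD_comp_radial|exact: hasD_coord].
rewrite /=. ring.
Qed.

End RadialCalculus.

Section RadialSmoothness.
Context {R : realType} {n : nat} (U : set 'rV[R]_(n + n)) (oU : open U).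

Lemma Ck_radial k : Ck frame U k (@radial R n).
Proof.
have cc j (b : 'I_(n + n)) : Ck frame U j (fun q : 'rV[R]_(n + n) => q 0 b).
  elim: j => [|j _]; first by split=> // x _; exact: differentiable_coord.
  apply: (CkS oU (df := fun i _ => (i == b)%:R)).
  - by move=> i x _; exact: hasD_coord.
  - by move=> x _; exact: differentiable_coord.
  - by move=> i; exact: Ck_cst.
case: k => [|k]; first by split=> // x _; exact: differentiable_radial.
apply: (CkS oU (df := fun a q => 2 * q 0 a)).
- by move=> i x _; exact: hasD_radial.
- by move=> x _; exact: differentiable_radial.
- by move=> i; apply: CkM => //; exact: Ck_cst.
Qed.

Lemma smooth_on_radialM (I : set R) (f : R -> R) (h : 'rV[R]_(n + n) -> R) :
  (forall x, U x -> I (radial x)) -> smooth1_on I f -> smooth_on U h ->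
  smooth_on U (fun q => f (radial q) * h q).
Proof.
move=> UI /smooth1_on_Ck f_smooth /smooth_on_Ck h_smooth.
apply/smooth_on_Ck => k; apply: CkM => //.
by apply: Ck_comp UI Ck_radial _.
Qed.

End RadialSmoothness.

(** * The complex Hessian and (1,1)-forms *)

Section Wirtinger.
Context {R : realType} {n : nat}.
Local Notation pt := 'rV[R]_(n + n).
Implicit Types (p q : pt) (i j : 'I_n).

Definition zrow p : 'rV[R[i]]_n := \row_i (p 0 (lshift n i) +i* p 0 (rshift n i)).
Definition zbarcol p : 'cV[R[i]]_n := \col_i (p 0 (lshift n i) -i* p 0 (rshift n i)).
Definition zbarz_mx p : 'M[R[i]]_n := zbarcol p *m zrow p.

Lemma half_complex : (2^-1 : R[i]) = (2^-1)%:C.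
Proof. by rewrite fmorphV rmorph_nat. Qed.

Lemma z_zbar p : zrow p *m zbarcol p = (radial p)%:C%:M.
Proof.
apply/matrixP => i j; rewrite !ord1 !mxE eqxx mulr1n /radial rmorph_sum.
by apply: eq_bigr => k _; rewrite !mxE; simpc; apply/eqP; rewrite eq_complex /= !expr2; apply/andP; split; apply/eqP; ring.
Qed.

Lemma zbarz_mxE p i j : zbarz_mx p i j =
  (p 0 (lshift n i) * p 0 (lshift n j) + p 0 (rshift n i) * p 0 (rshift n j))
  +i* (p 0 (lshift n i) * p 0 (rshift n j) - p 0 (rshift n i) * p 0 (lshift n j)).
Proof.
rewrite mxE big_ord1 !mxE; simpc.
by apply/eqP; rewrite eq_complex /=; apply/andP; split; apply/eqP; ring.
Qed.

Lemma zbarz_mx2 p : zbarz_mx p *m zbarz_mx p = (radial p)%:C *: zbarz_mx p.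
Proof. by rewrite /zbarz_mx mulmxA -(mulmxA _ (zrow p)) z_zbar mul_mx_scalar -scalemxAl. Qed.

Lemma zbarz_mx_tr p : \tr (zbarz_mx p) = (radial p)%:C.
Proof. by rewrite mxtrace_mulC z_zbar mxtrace_scalar mulr1n. Qed.

(** The first derivatives of F are 2 p_a f1, so d F / dzbar_j = f1 z_j; a second
    derivation gives the Hessian. It is stated for a function that agrees with a
    radial one on U only, which is the situation of log det. *)
Lemma ddbar_radial (U : set pt) (I : set R) (F : pt -> R) (f f1 f2 : R -> R) p :
  open U -> (forall q, U q -> I (radial q)) ->
  (forall t, I t -> hasD (1 : R) f t (f1 t)) ->
  (forall t, I t -> hasD (1 : R) f1 t (f2 t)) ->
  (forall q, U q -> F q = f (radial q)) -> U p ->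
  ddbar F p = (f1 (radial p))%:C%:M + (f2 (radial p))%:C *: zbarz_mx p.
Proof.
move=> oU UI df df1 FE Up; apply/matrixP => i j.
have pdF a q : U q -> pd a F q = 2 * q 0 a * f1 (radial q).
  move=> Uq; rewrite /pd; apply: hasD_val.
  apply: (hasD_on oU Uq _ (hasD_comp_radial df a (UI _ Uq))) => y Uy.
  by rewrite FE.
have pd0 a q : pd a (fun _ : pt => 0) q = 0.
  exact: hasD_val (hasD_cst _ _ _).
have dbE q : U q -> delbar j (fun y => (F y)%:C) q =
   (f1 (radial q) * q 0 (lshift n j)) +i* (f1 (radial q) * q 0 (rshift n j)).
  move=> Uq; rewrite /delbar /pdC /= !pd0 !pdF// half_complex; simpc.
  by apply/eqP; rewrite eq_complex /=; apply/andP; split; apply/eqP; field.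
have pdRe a : pd a (fun q => complex.Re (delbar j (fun y => (F y)%:C) q)) p =
  2 * p 0 a * p 0 (lshift n j) * f2 (radial p) + (a == lshift n j)%:R * f1 (radial p).
  apply: hasD_val.
  apply: (hasD_on oU Up _ (hasD_radial_coord df1 a _ (UI _ Up))) => y Uy.
  by rewrite dbE.
have pdIm a : pd a (fun q => complex.Im (delbar j (fun y => (F y)%:C) q)) p =
  2 * p 0 a * p 0 (rshift n j) * f2 (radial p) + (a == rshift n j)%:R * f1 (radial p).
  apply: hasD_val.
  apply: (hasD_on oU Up _ (hasD_radial_coord df1 a _ (UI _ Up))) => y Uy.
  by rewrite dbE.
rewrite mxE [RHS]mxE [_%:M i j]mxE [X in _ + X]mxE zbarz_mxE /del /pdC !pdRe !pdIm half_complex.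
rewrite eq_lshift eq_rshift eq_lrshift eq_rlshift.
rewrite -rmorphMn /= -[f1 _ *+ _]mulr_natl.
simpc.
by apply/eqP; rewrite eq_complex /=; apply/andP; split; apply/eqP; field.
Qed.

Lemma hermitian_mxE (g : pt -> 'M[R]_(n + n)) p i j : hermitian_mx g p i j =
  ((g p (lshift n i) (lshift n j) + g p (rshift n i) (rshift n j)) / 4)
  +i* ((g p (lshift n i) (rshift n j) - g p (rshift n i) (lshift n j)) / 4).
Proof.
rewrite /hermitian_mx /dz_vec /dzbar_vec.
rewrite -{1}(submxK (g p)) map_block_mx.
rewrite linearZ /= -!scalemxAl -scalemxAr scalerA tr_row_mx !tr_scalar_mx.
rewrite mul_row_block mul_row_col !mul1mx mulmx1 mul_mx_scalar !mul_scalar_mx.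
rewrite !mxE half_complex; simpc.
by apply/eqP; rewrite eq_complex /=; apply/andP; split; apply/eqP; field.
Qed.

(** In the block decomposition of dz_i and dzbar_j, the product dz h dzbar^T has
    the blocks h, - i h, i h, h. *)
Lemma form11E (h : 'M[R[i]]_n) :
  let T := block_mx h (- 'i%C *: h) ('i%C *: h) h in
  forall a b, form11 h a b = 'i%C * (T a b - T b a).
Proof.
move=> T a b; rewrite /form11 /dz_form /dzbar_form tr_col_mx !tr_scalar_mx mul_col_mx.
rewrite mul_col_row !mul1mx !mulmx1 !mul_mx_scalar mul_scalar_mx scalerA mulNr.
by rewrite -expr2 sqr_i opprK scale1r -/T mxE [X in _ * X]mxE [X in _ + X]mxE [X in - X]mxE.
Qed.

Lemma form11_ll (h : 'M[R[i]]_n) i j :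
  form11 h (lshift n i) (lshift n j) = 'i%C * (h i j - h j i).
Proof. by rewrite form11E !block_mxEul. Qed.

Lemma form11_lr (h : 'M[R[i]]_n) i j :
  form11 h (lshift n i) (rshift n j) = h i j + h j i.
Proof.
rewrite form11E block_mxEur block_mxEdl [(_ *: h) i j]mxE [(_ *: h) j i]mxE.
transitivity (- ('i%C ^+ 2) * (h i j + h j i)); first by ring.
by rewrite sqr_i opprK mul1r.
Qed.

Lemma form11_rr (h : 'M[R[i]]_n) i j :
  form11 h (rshift n i) (rshift n j) = 'i%C * (h i j - h j i).
Proof. by rewrite form11E !block_mxEdr. Qed.

Lemma form11_anti (h : 'M[R[i]]_n) a b : form11 h a b = - form11 h b a.
Proof. by rewrite /form11 !mxE -mulrN opprB. Qed.

End Wirtinger.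

(** * The metric defined by a radial potential *)

Section RadialForm.
Context {R : realType} {n : nat}.
Local Notation pt := 'rV[R]_(n + n).

Lemma form11_radial (x y : R) (p : pt) a b :
  form11 (x%:C%:M + y%:C *: zbarz_mx p) a b =
  (jsign a * (2 * x * (jswap a == b)%:R + 2 * y * cline_mx p (jswap a) b))%:C.
Proof.
have hE i j : (x%:C%:M + y%:C *: zbarz_mx p) i j =
  (x * (i == j)%:R + y * (p 0 (lshift n i) * p 0 (lshift n j) + p 0 (rshift n i) * p 0 (rshift n j)))
  +i* (y * (p 0 (lshift n i) * p 0 (rshift n j) - p 0 (rshift n i) * p 0 (lshift n j))).
  rewrite mxE [_%:M i j]mxE [X in _ + X]mxE zbarz_mxE -rmorphMn /= -[x *+ _]mulr_natl.
  by simpc; apply/eqP; rewrite eq_complex /=; apply/andP; split; apply/eqP; ring.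
case: (lrP a) => i _; case: (lrP b) => j _; last first.
- rewrite form11_rr !hE jswapr jsignr mxE jswapl jswapr jsignl jsignr eq_lrshift (eq_sym j).
  by simpc; apply/eqP; rewrite eq_complex /=; apply/andP; split; apply/eqP; ring.
- rewrite form11_anti form11_lr !hE jswapr jsignr mxE !jswapl !jsignl eq_lshift (eq_sym j).
  by simpc; apply/eqP; rewrite eq_complex /=; apply/andP; split; apply/eqP; ring.
- rewrite form11_lr !hE jswapl jsignl mxE !jswapr !jsignr eq_rshift (eq_sym j).
  by simpc; apply/eqP; rewrite eq_complex /=; apply/andP; split; apply/eqP; ring.
- rewrite form11_ll !hE jswapl jsignl mxE jswapl jswapr jsignl jsignr eq_rlshift (eq_sym j).
  by simpc; apply/eqP; rewrite eq_complex /=; apply/andP; split; apply/eqP; ring.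
Qed.

Definition radial_metric (x y : R) (p : pt) : 'M[R]_(n + n) :=
  (2 * x)%:M + (2 * y) *: cline_mx p.

Lemma radial_metricE x y p a b :
  radial_metric x y p a b = 2 * x * (a == b)%:R + 2 * y * cline_mx p a b.
Proof. by rewrite mxE [_%:M a b]mxE [X in _ + X]mxE mulr_natr. Qed.

(** The associated form determines the metric because J0 is invertible. *)
Lemma assoc_form_radial (x y : R) (g : pt -> 'M[R]_(n + n)) p :
  map_mx (real_complex R) (assoc_form g p) =
    form11 (x%:C%:M + y%:C *: zbarz_mx p) -> g p = radial_metric x y p.
Proof.
move=> gE; apply/matrixP => a b; rewrite radial_metricE.
have := congr1 (fun A : 'M[R[i]]_(n + n) => A (jswap a) b) gE.
rewrite mxE mulJ0E form11_radial jswapK => /complexI.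
by rewrite jsign_swap => /(mulfI _); apply; rewrite oppr_eq0 jsign_neq0.
Qed.

Lemma hermitian_mx_radial (x y : R) (g : pt -> 'M[R]_(n + n)) p :
  g p = radial_metric x y p ->
  hermitian_mx g p = x%:C%:M + y%:C *: zbarz_mx p.
Proof.
move=> gE; apply/matrixP => i j; rewrite hermitian_mxE gE !radial_metricE.
rewrite [RHS]mxE [(_%:M : 'M[R[i]]_n) i j]mxE [X in _ = _ + X]mxE zbarz_mxE -rmorphMn /= -[x *+ _]mulr_natl.
rewrite !mxE !jswapl !jswapr !jsignl !jsignr eq_lshift eq_rshift eq_lrshift eq_rlshift.
by simpc; apply/eqP; rewrite eq_complex /=; apply/andP; split; apply/eqP; field.
Qed.

(** idempotent_inverse with a = 2 x, b = 2 y and N = cline_mx p. *)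
Definition radial_inv (x y : R) (p : pt) : 'M[R]_(n + n) :=
  (2 * x)^-1 *: (1%:M - (y / (x + radial p * y)) *: cline_mx p).

Lemma radial_invE x y p a b : radial_inv x y p a b =
  (2 * x)^-1 * ((a == b)%:R - y / (x + radial p * y) * cline_mx p a b).
Proof. by rewrite mxE [X in _ * X]mxE [_%:M a b]mxE [X in _ + X]mxE [X in - X]mxE. Qed.

Context (x y : R) (p : pt).
Hypothesis x0 : x != 0.
Hypothesis xy0 : x + radial p * y != 0.
Local Notation Gi := (radial_inv x y p).

Lemma radial_invK : Gi *m radial_metric x y p = 1%:M.
Proof.
have nz2 : (2 : R) != 0 by rewrite pnatr_eq0.
have -> : Gi = (2 * x)^-1 *: (1%:M - (2 * y / (2 * x + radial p * (2 * y))) *: cline_mx p).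
  by congr (_ *: (_ - _ *: _)); field; rewrite xy0 /=; rewrite mulrCA -mulrDr mulf_neq0.
by apply: idempotent_inverse; rewrite ?mulf_neq0 ?cline_mx2// mulrCA -mulrDr mulf_neq0.
Qed.

Lemma radial_inv_sym a b : Gi a b = Gi b a.
Proof. by rewrite !radial_invE cline_mx_sym eq_sym. Qed.

Lemma radial_invJ a b : Gi (jswap a) (jswap b) = jsign a * jsign b * Gi a b.
Proof.
rewrite !radial_invE cline_mxJ (inj_eq (inv_inj jswapK)).
have E : (a == b)%:R = jsign a * jsign b * (a == b)%:R :> R.
  by case: eqP => [->|]; rewrite ?jsign2 ?mul1r ?mulr0.
by rewrite {1}E; ring.
Qed.

Lemma radial_inv_p a : \sum_b Gi a b * p 0 b = p 0 a / (2 * (x + radial p * y)).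
Proof.
transitivity ((2 * x)^-1 * (\sum_b (a == b)%:R * p 0 b -
   y / (x + radial p * y) * \sum_b cline_mx p a b * p 0 b)).
  rewrite !big_distrr -sumrB big_distrr; apply: eq_bigr => b _ /=.
  by rewrite radial_invE; ring.
by rewrite sum_deltal cline_mx_p; field; rewrite x0 xy0.
Qed.

Lemma contract_inv_pp : contract Gi (fun a b => p 0 a * p 0 b) =
  radial p / (2 * (x + radial p * y)).
Proof.
transitivity (\sum_a p 0 a * \sum_b Gi a b * p 0 b).
  by apply: eq_bigr => a _; rewrite big_distrr; apply: eq_bigr => b _ /=; ring.
rewrite radialE big_distrl; apply: eq_bigr => a _; rewrite radial_inv_p /=.
by rewrite mulrA -radialE.
Qed.

(** The g-trace does not change when J is applied to both arguments of T. *)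
Lemma contract_swap (T : 'I_(n + n) -> 'I_(n + n) -> R) :
  contract Gi (fun a b => jsign a * jsign b * T (jswap a) (jswap b)) = contract Gi T.
Proof.
rewrite [RHS]/contract -[RHS]sum_swap; apply: eq_bigr => a _.
by rewrite -[RHS]sum_swap; apply: eq_bigr => b _; rewrite radial_invJ; ring.
Qed.

Lemma contract_inv_cline : contract Gi (cline_mx p) = radial p / (x + radial p * y).
Proof.
rewrite (@eq_contract _ _ _ _ (fun a b => p 0 a * p 0 b +
    jsign a * jsign b * (p 0 (jswap a) * p 0 (jswap b)))); last by move=> a b; rewrite mxE.
rewrite contractD (contract_swap (fun a b => p 0 a * p 0 b)) contract_inv_pp.
by field; rewrite xy0.
Qed.

Lemma contract_inv_delta : contract Gi (fun a b => (a == b)%:R) =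
  (n%:R - radial p * y / (x + radial p * y)) / x.
Proof.
transitivity (\sum_a Gi a a).
  by apply: eq_bigr => a _; under eq_bigr do rewrite mulrC; rewrite sum_deltal.
under eq_bigr do rewrite radial_invE eqxx.
rewrite -big_distrr sumrB -big_distrr/= sumr_const card_ord cline_mx_tr natrD.
by field; rewrite x0 xy0.
Qed.

End RadialForm.

(** * Curvature of a radial conformal change of a radial Kahler metric *)

Lemma pd_on {R : realType} {m} (U : set 'rV[R]_m) a f h p : open U -> U p ->
  (forall q, U q -> f q = h q) -> pd a f p = pd a h p.
Proof.
move=> oU Up fh; apply: near_eq_derive; near=> y; apply: fh; near: y.
exact: open_nbhs_nbhs.
Unshelve. all: by end_near. Qed.

Lemma real_trace {R : realType} (n : nat) (c x y d r : R) :
  2 * - ((c%:C)^-1 * (x%:C * (n%:R - d%:C * r%:C) + y%:C * (r%:C * (1 - d%:C * r%:C))))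
  = (2 * - (c^-1 * (x * (n%:R - d * r) + y * (r * (1 - d * r)))))%:C :> R[i].
Proof.
rewrite (rmorphM (real_complex R)) (rmorphN (real_complex R)) rmorph_nat.
rewrite (rmorphM (real_complex R)) fmorphV.
by rewrite !(rmorphD, rmorphN, rmorphM, rmorph_nat, rmorph1).
Qed.

Section KahlerAnnulus.
Context {R : realType} {n : nat} (al : R) (be : \bar R).
Local Notation pt := 'rV[R]_(n + n).
Local Notation I := (oint al be).
Local Notation U := (annulus n al be).
Context (g : pt -> 'M[R]_(n + n)) (phi1 phi2 phi3 : R -> R).
Let psi t := phi1 t + t * phi2 t.
Hypothesis d1 : forall t, I t -> hasD (1 : R) phi1 t (phi2 t).
Hypothesis d2 : forall t, I t -> hasD (1 : R) phi2 t (phi3 t).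
Hypothesis phi1_gt0 : forall t, I t -> 0 < phi1 t.
Hypothesis psi_gt0 : forall t, I t -> 0 < psi t.
Hypothesis gE : forall p, U p -> g p = radial_metric (phi1 (radial p)) (phi2 (radial p)) p.
Hypothesis g_smooth : forall a b, smooth_on U (fun p => g p a b).
Hypothesis g_closed : closed2 U (assoc_form g).

Let oU : open U. Proof. exact: open_annulus. Qed.
Let UI p : U p -> I (radial p). Proof. by []. Qed.

Let phi1_neq0 p : U p -> phi1 (radial p) != 0.
Proof. by move=> Up; rewrite gt_eqF// phi1_gt0. Qed.
Let psi_neq0 p : U p -> phi1 (radial p) + radial p * phi2 (radial p) != 0.
Proof. by move=> Up; rewrite gt_eqF// psi_gt0. Qed.

Local Notation gi p := (radial_inv (phi1 (radial p)) (phi2 (radial p)) p).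

Lemma invmx_g p : U p -> invmx (g p) = gi p.
Proof.
by move=> Up; apply: mulmx1_invmx; rewrite gE//; apply: radial_invK;
  [exact: phi1_neq0|exact: psi_neq0].
Qed.

Lemma giG p : U p -> forall j l, \sum_k gi p j k * g p k l = (j == l)%:R.
Proof.
move=> Up j l; have := congr1 (fun A : 'M[R]_(n + n) => A j l)
  (radial_invK (phi1_neq0 Up) (psi_neq0 Up)).
by rewrite -gE// !mxE.
Qed.

Lemma g_sym p : U p -> forall a b, g p a b = g p b a.
Proof. by move=> Up a b; rewrite gE// !radial_metricE cline_mx_sym eq_sym. Qed.

Lemma gJ p : U p -> forall a b,
  g p (jswap a) (jswap b) = jsign a * jsign b * g p a b.
Proof.
move=> Up a b; rewrite gE// !radial_metricE cline_mxJ (inj_eq (inv_inj jswapK)).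
have E : (a == b)%:R = jsign a * jsign b * (a == b)%:R :> R.
  by case: eqP => [->|]; rewrite ?jsign2 ?mul1r ?mulr0.
by rewrite {1}E; ring.
Qed.

Definition dmetric (a b c : 'I_(n + n)) p := pd a (fun q => g q b c) p.

Lemma hasD_g a b c p : U p -> hasD (frame a) (fun q => g q b c) p (dmetric a b c p).
Proof. by move=> Up; split=> //; exact: (@g_smooth b c [::] p Up). Qed.

Lemma dmetric_sym p a b c : U p -> dmetric a b c p = dmetric a c b p.
Proof. by move=> Up; apply: (pd_on _ oU Up) => q Uq; rewrite g_sym. Qed.

Lemma dmetricJ p a b c : U p ->
  dmetric a (jswap b) (jswap c) p = jsign b * jsign c * dmetric a b c p.
Proof.
move=> Up; apply: hasD_val.
apply: (hasD_on oU Up _ (hasD_Ml (jsign b * jsign c) (hasD_g a b c Up))) => q Uq.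
by rewrite gJ.
Qed.

Lemma dmetric_closed p a b c : U p ->
  jsign b * dmetric a (jswap b) c p + jsign c * dmetric b (jswap c) a p +
  jsign a * dmetric c (jswap a) b p = 0.
Proof.
move=> Up; rewrite -[RHS](g_closed a b c Up).
have E x y z : pd x (fun q => assoc_form g q y z) p = jsign y * dmetric x (jswap y) z p.
  apply: hasD_val.
  apply: (hasD_on oU Up _ (hasD_Ml (jsign y) (hasD_g x (jswap y) z Up))) => q Uq.
  by rewrite /assoc_form mulJ0E.
by rewrite !E.
Qed.

Definition lower_christoffel (j k l : 'I_(n + n)) p := dmetric j k l p + dmetric k j l p - dmetric l j k p.

Lemma sign_cases (a : 'I_(n + n)) : (jsign a = 1 :> R) \/ (jsign a = -1 :> R).
Proof. by case: (lrP a) => i _; rewrite ?(jsignl, jsignr); [left|right]. Qed.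

(** The Kahler condition on first derivatives: d omega evaluated on (X, Y, JZ)
    and on (X, JY, Z) expresses the two derivatives of g in a direction J e_k,
    J e_l through derivatives in the directions e_j, e_k, e_l. *)
Lemma lower_christoffelJ p j k l : U p ->
  lower_christoffel j (jswap k) (jswap l) p = jsign k * jsign l * lower_christoffel j k l p.
Proof.
move=> Up; rewrite /lower_christoffel.
have := dmetric_closed j k (jswap l) Up; have := dmetric_closed j (jswap k) l Up.
rewrite !jswapK !jsign_swap (dmetricJ j k l Up) (dmetricJ l j k Up).
rewrite (dmetric_sym (jswap k) (jswap l) j Up) (dmetric_sym k l j Up).
have := dmetricJ (jswap l) j (jswap k) Up; rewrite jswapK jsign_swap => ->.
(* For each choice of signs the goal is a linear combination of the two
   closedness relations. *)
by case: (sign_cases j) => ->; case: (sign_cases k) => ->;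
  case: (sign_cases l) => ->; lra.
Qed.

Lemma christoffelE p k i j : U p ->
  christoffel g k i j p = 2^-1 * \sum_l gi p k l * lower_christoffel i j l p.
Proof. by move=> Up; rewrite /christoffel invmx_g. Qed.

Lemma christoffel_sym p k i j : U p ->
  christoffel g k i j p = christoffel g k j i p.
Proof.
move=> Up; rewrite !christoffelE//; congr (_ * _); apply: eq_bigr => l _.
by rewrite /lower_christoffel (dmetric_sym l i j Up); ring.
Qed.

(** Gamma(X, JY) = J Gamma(X, Y), that is, J is parallel. *)
Lemma christoffelJ p l j k : U p ->
  christoffel g (jswap l) j (jswap k) p =
  jsign l * jsign k * christoffel g l j k p.
Proof.
move=> Up; rewrite !christoffelE// mulrCA; congr (_ * _).
rewrite -[LHS]sum_swap big_distrr; apply: eq_bigr => s _ /=.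
rewrite lower_christoffelJ// radial_invJ.
transitivity (jsign s * jsign s * (jsign l * jsign k * (gi p l s * lower_christoffel j k s p))).
  by ring.
by rewrite jsign2 mul1r.
Qed.

(** In the contracted Christoffel symbols the first and third derivatives of g
    are exchanged by symmetry and cancel. *)
Lemma trace_christoffel p k : U p ->
  \sum_i christoffel g i i k p = 2^-1 * contract (gi p) (fun a b => dmetric k a b p).
Proof.
move=> Up; under eq_bigr do rewrite christoffelE//.
rewrite -big_distrr; congr (_ * _).
have E : contract (gi p) (fun i l => dmetric i k l p) =
    contract (gi p) (fun i l => dmetric l i k p).
  rewrite -(contract_tr _ (@radial_inv_sym _ _ _ _ _)).
  by apply: eq_contract => a b; rewrite dmetric_sym.
rewrite -[LHS]/(contract (gi p) (fun i l => lower_christoffel i k l p)) /lower_christoffel contractB contractD E.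
by rewrite addrC addKr.
Qed.

Lemma dmetricE p k a b : U p -> dmetric k a b p =
  2 * p 0 k * (2 * phi2 (radial p) * (a == b)%:R + 2 * phi3 (radial p) * cline_mx p a b)
  + 2 * phi2 (radial p) * (((k == a)%:R * p 0 b + p 0 a * (k == b)%:R)
    + jsign a * jsign b * ((k == jswap a)%:R * p 0 (jswap b)
                     + p 0 (jswap a) * (k == jswap b)%:R)).
Proof.
move=> Up; apply: hasD_val.
apply: (hasD_on oU Up (f := fun q => 2 * ((a == b)%:R * phi1 (radial q)) +
   2 * (phi2 (radial q) * (q 0 a * q 0 b + jsign a * jsign b *
       (q 0 (jswap a) * q 0 (jswap b)))))) => [q Uq|].
  by rewrite gE// radial_metricE mxE; ring.
apply: hasD_eq.
  apply: hasD_D; apply: hasD_Ml.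
    by apply: hasD_Ml; apply: hasD_comp_radial (UI Up); exact: d1.
  apply: hasD_M; first by apply: hasD_comp_radial (UI Up); exact: d2.
  apply: hasD_D; first by apply: hasD_M; exact: hasD_coord.
  by apply: hasD_Ml; apply: hasD_M; exact: hasD_coord.
by rewrite mxE /=; ring.
Qed.

(** The derivative of log(phi1^(n-1) psi), the logarithm of det(g_ij). *)
Definition dlog_vol t := (n%:R - 1) * phi2 t / phi1 t + (2 * phi2 t + t * phi3 t) / psi t.

(** Half of it is the derivative of log sqrt(det g), hence the trace of Gamma.
    The terms of dmetric that differentiate cline_mx are traces against p_b, where
    g^ab p_b = p_a / (2 psi). *)
Lemma contract_dmetric p k : U p ->
  contract (gi p) (fun a b => dmetric k a b p) = 2 * (2 * p 0 k * dlog_vol (radial p)).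
Proof.
move=> Up; rewrite (eq_contract _ (fun a b => dmetricE k a b Up)).
rewrite contractD !contractZ contractD !contractZ contractD.
rewrite (contract_swap _ _ _ (fun a b => (k == a)%:R * p 0 b + p 0 a * (k == b)%:R)).
have E : contract (gi p) (fun a b => (k == a)%:R * p 0 b) =
    p 0 k / (2 * psi (radial p)).
  rewrite -radial_inv_p; [|exact: phi1_neq0|exact: psi_neq0].
  rewrite -[RHS](sum_deltal k (fun k => \sum_b gi p k b * p 0 b)).
  by apply: eq_bigr => a _; rewrite big_distrr; apply: eq_bigr => b _ /=; ring.
have E2 : contract (gi p) (fun a b => p 0 a * (k == b)%:R) = p 0 k / (2 * psi (radial p)).
  rewrite -E -[RHS](contract_tr _ (@radial_inv_sym _ _ _ _ _)).
  by apply: eq_contract => a b; rewrite mulrC.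
have x0 := phi1_neq0 Up; have xy0 := psi_neq0 Up.
rewrite contractD E E2 contract_inv_delta ?contract_inv_cline//.
by rewrite /dlog_vol /psi; field; rewrite x0 xy0.
Qed.


Lemma Ck0_radial (f : R -> R) : (forall t, I t -> differentiable f t) ->
  Ck frame U 0 (fun q => f (radial q)).
Proof.
move=> df; apply: (Ck_comp oU UI) => [k|]; first exact: Ck_radial.
by split.
Qed.

Lemma Ck0_coord a : Ck frame U 0 (fun q : pt => q 0 a).
Proof. by split=> // q _; exact: differentiable_coord. Qed.

Lemma Ck0_inv a b : Ck frame U 0 (fun q => gi q a b).
Proof.
have p1 : Ck frame U 0 (fun q : pt => phi1 (radial q)).
  by apply: Ck0_radial => t It; exact: hasD_differentiable (d1 It).
have p2 : Ck frame U 0 (fun q : pt => phi2 (radial q)).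
  by apply: Ck0_radial => t It; exact: hasD_differentiable (d2 It).
apply: (Ck_eq oU (f := fun q => (2 * phi1 (radial q))^-1 * ((a == b)%:R +
    (-1) * (phi2 (radial q) * (phi1 (radial q) + radial q * phi2 (radial q))^-1 *
    (q 0 a * q 0 b + jsign a * jsign b * (q 0 (jswap a) * q 0 (jswap b)))))))
  => [q Uq|].
  by rewrite radial_invE mxE; ring.
apply: (CkM oU).
  apply: (CkV oU) => [q Uq|]; first by rewrite mulf_neq0 ?pnatr_eq0 ?phi1_neq0.
  by apply: (CkM oU) => //; exact: Ck_cst.
apply: (CkD oU); first exact: Ck_cst.
apply: (CkM oU); first exact: Ck_cst.
apply: (CkM oU).
  apply: (CkM oU) => //; apply: (CkV oU) => [q Uq|]; first exact: psi_neq0.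
  by apply: (CkD oU) => //; apply: (CkM oU) => //; exact: Ck_radial.
apply: (CkD oU); first by apply: (CkM oU); exact: Ck0_coord.
apply: (CkM oU); first exact: Ck_cst.
by apply: (CkM oU); exact: Ck0_coord.
Qed.

Lemma Ck0_dmetric a b c : Ck frame U 0 (dmetric a b c).
Proof. by split=> // q Uq; exact: (@g_smooth b c [:: a] q Uq). Qed.

Lemma christoffel_differentiable p k i j : U p ->
  differentiable (christoffel g k i j) p.
Proof.
move=> Up; apply: (hasD_differentiable (v := 0)).
apply: (hasD_on oU Up (f := fun q => 2^-1 * \sum_l gi q k l * lower_christoffel i j l q)).
  by move=> q Uq; rewrite christoffelE.
apply: hasD_Ml; apply: hasD_sum => l; apply: hasD_M.
  by apply: differentiable_hasD; exact: Ck_diff Up (Ck0_inv _ _).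
by apply: hasD_B; [apply: hasD_D|]; apply: differentiable_hasD;
  exact: Ck_diff Up (Ck0_dmetric _ _ _).
Qed.

Definition dchristoffel (a k i j : 'I_(n + n)) p := pd a (christoffel g k i j) p.

Lemma hasD_christoffel a k i j p : U p ->
  hasD (frame a) (christoffel g k i j) p (dchristoffel a k i j p).
Proof. by move=> Up; split=> //; exact: christoffel_differentiable. Qed.

Lemma dchristoffel_sym p a k i j : U p -> dchristoffel a k i j p = dchristoffel a k j i p.
Proof. by move=> Up; apply: (pd_on _ oU Up) => q Uq; exact: christoffel_sym. Qed.

Lemma dchristoffelJ p a l j k : U p ->
  dchristoffel a (jswap l) j (jswap k) p = jsign l * jsign k * dchristoffel a l j k p.
Proof.
move=> Up; apply: hasD_val.
apply: (hasD_on oU Up _ (hasD_Ml (jsign l * jsign k) (hasD_christoffel a l j k Up))) => q Uq.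
by rewrite christoffelJ.
Qed.

(** l is the logarithmic derivative of rho. Prescribing l instead of dividing
    the derivative of rho by rho allows an explicit l for the solutions of the
    equation. *)
Context (l l1 rho : R -> R) (dlog_vol1 : R -> R).
Hypothesis dl : forall t, I t -> hasD (1 : R) l t (l1 t).
Hypothesis drho : forall t, I t -> hasD (1 : R) rho t (rho t * l t).
Hypothesis rho_gt0 : forall t, I t -> 0 < rho t.
Hypothesis d_dlog_vol : forall t, I t -> hasD (1 : R) dlog_vol t (dlog_vol1 t).

Local Notation rg := (fun p : pt => rho (radial p) *: g p).
(** The differential of log(rho(r)) / 2 and its g-gradient. *)
Let dlog_rho (p : pt) (a : 'I_(n + n)) := l (radial p) * p 0 a.
Let kap t := l t / (2 * psi t).
Let grad_rho (p : pt) (a : 'I_(n + n)) := kap (radial p) * p 0 a.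

Let rho_neq0 p : U p -> rho (radial p) != 0.
Proof. by move=> Up; rewrite gt_eqF// rho_gt0. Qed.

Lemma invmx_rg p : U p -> invmx (rg p) = (rho (radial p))^-1 *: gi p.
Proof.
move=> Up; apply: mulmx1_invmx; rewrite -scalemxAl -scalemxAr scalerA mulVf ?rho_neq0//.
by rewrite scale1r gE// radial_invK ?phi1_neq0// psi_neq0.
Qed.

Lemma g_grad_rho p k : U p -> \sum_i g p k i * grad_rho p i = dlog_rho p k.
Proof.
move=> Up; have x0 := phi1_neq0 Up; have xy0 := psi_neq0 Up.
transitivity (kap (radial p) * (2 * phi1 (radial p) * (\sum_i (k == i)%:R * p 0 i) +
   2 * phi2 (radial p) * \sum_i cline_mx p k i * p 0 i)).
  rewrite !big_distrr -big_split big_distrr; apply: eq_bigr => i _ /=.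
  by rewrite gE// radial_metricE /grad_rho; ring.
by rewrite sum_deltal cline_mx_p /kap /dlog_rho /psi; field.
Qed.

Lemma hasD_rg a b c p : U p -> hasD (frame a) (fun q => rg q b c) p
  (rho (radial p) * (2 * dlog_rho p a * g p b c + dmetric a b c p)).
Proof.
move=> Up; apply: (hasD_ext (f := fun q => rho (radial q) * g q b c)) => [q|].
  by rewrite mxE.
apply: hasD_eq; first apply: hasD_M.
- by apply: hasD_comp_radial (UI Up); exact: drho.
- exact: hasD_g.
by rewrite /dlog_rho /=; ring.
Qed.

Lemma christoffel_rg p k i j : U p -> christoffel rg k i j p =
  christoffel g k i j p + corr (g p) (dlog_rho p) (grad_rho p) k i j.
Proof.
move=> Up; rewrite christoffelE// /christoffel invmx_rg//.
have r0 := rho_neq0 Up.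
transitivity (2^-1 * \sum_s gi p k s * (lower_christoffel i j s p + 2 * (dlog_rho p i * g p j s
   + dlog_rho p j * g p i s - dlog_rho p s * g p i j))).
  congr (_ * _); apply: eq_bigr => s _; rewrite /pd.
  rewrite !(hasD_val (hasD_rg _ _ _ Up)) mxE /lower_christoffel; field; exact: r0.
transitivity (2^-1 * (\sum_s gi p k s * lower_christoffel i j s p) + (dlog_rho p i * (\sum_s gi p k s * g p s j)
   + dlog_rho p j * (\sum_s gi p k s * g p s i) - g p i j * \sum_s gi p k s * dlog_rho p s)).
  rewrite !big_distrr -big_split -sumrB -big_split; apply: eq_bigr => s _ /=.
  by rewrite (g_sym Up s j) (g_sym Up s i); field.
by rewrite !giG// (raise_index (giG Up) (fun a => g_grad_rho a Up)) /corr; ring.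
Qed.

Let d_dlog_rho (p : pt) (a b : 'I_(n + n)) :=
  (a == b)%:R * l (radial p) + 2 * l1 (radial p) * (p 0 a * p 0 b).
Let dlog_vol_form (p : pt) (a : 'I_(n + n)) : R := 2 * (dlog_vol (radial p) * p 0 a).
Let df (p : pt) (a b : 'I_(n + n)) : R :=
  2 * ((a == b)%:R * dlog_vol (radial p) + 2 * dlog_vol1 (radial p) * (p 0 a * p 0 b)).
Let kap1 t := (l1 t * psi t - l t * (2 * phi2 t + t * phi3 t)) / (2 * psi t ^+ 2).
Let d_grad_rho (p : pt) (a b : 'I_(n + n)) :=
  (a == b)%:R * kap (radial p) + 2 * kap1 (radial p) * (p 0 a * p 0 b).

Lemma hasD_dlog_rho a b p : U p -> hasD (frame a) (fun q => dlog_rho q b) p (d_dlog_rho p a b).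
Proof.
move=> Up; apply: hasD_eq (hasD_radial_coord dl a b (UI Up)) _.
by rewrite /d_dlog_rho; ring.
Qed.

Lemma hasD_dlog_vol_form a b p : U p -> hasD (frame a) (fun q => dlog_vol_form q b) p (df p a b).
Proof.
move=> Up; apply: hasD_eq (hasD_Ml 2 (hasD_radial_coord d_dlog_vol a b (UI Up))) _.
by rewrite /df; ring.
Qed.

Lemma hasD_psi t : I t -> hasD (1 : R) psi t (2 * phi2 t + t * phi3 t).
Proof.
move=> It; apply: hasD_eq.
  apply: hasD_D; first exact: d1.
  apply: hasD_M; last exact: d2.
  by apply/is_derive_hasD; exact: is_derive_id.
by rewrite /=; ring.
Qed.

Lemma hasD_kap t : I t -> hasD (1 : R) kap t (kap1 t).
Proof.
move=> It; have p0 : psi t != 0 by rewrite gt_eqF// psi_gt0.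
apply: hasD_eq.
  apply: hasD_M; first exact: dl.
  apply: hasD_V; first by rewrite mulf_neq0 ?pnatr_eq0.
  by apply: hasD_Ml; exact: hasD_psi.
by rewrite /kap1 /=; field.
Qed.

Lemma hasD_grad_rho a b p : U p -> hasD (frame a) (fun q => grad_rho q b) p (d_grad_rho p a b).
Proof.
move=> Up; apply: hasD_eq (hasD_radial_coord hasD_kap a b (UI Up)) _.
by rewrite /d_grad_rho; ring.
Qed.

Lemma hasD_christoffel_rg a k i j p : U p ->
  hasD (frame a) (christoffel rg k i j) p (dchristoffel a k i j p +
    ((k == i)%:R * d_dlog_rho p a j + (k == j)%:R * d_dlog_rho p a i
     - (dmetric a i j p * grad_rho p k + g p i j * d_grad_rho p a k))).
Proof.
move=> Up; apply: (hasD_on oU Up (f := fun q => christoffel g k i j q +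
    ((k == i)%:R * dlog_rho q j + (k == j)%:R * dlog_rho q i - g q i j * grad_rho q k))).
  by move=> q Uq; rewrite christoffel_rg.
apply: hasD_D; first exact: hasD_christoffel.
apply: hasD_B; last by apply: hasD_M; [exact: hasD_g|exact: hasD_grad_rho].
by apply: hasD_D; apply: hasD_Ml; exact: hasD_dlog_rho.
Qed.

(** Both traces are gradients of logarithms of volume densities; the term
    d_j Gamma^i_ik of the Ricci tensor is therefore a Hessian. *)
Lemma trace_christoffel_rg q k : U q ->
  \sum_i christoffel rg i i k q = dlog_vol_form q k + (n + n)%:R * dlog_rho q k.
Proof.
move=> Uq; under eq_bigr do rewrite christoffel_rg//.
rewrite big_split/= trace_christoffel// contract_dmetric//.
rewrite (trace_corr (g_sym Uq) (fun a => g_grad_rho a Uq)) /dlog_vol_form; congr (_ + _).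
by field.
Qed.

Lemma hasD_trace_rg j k p : U p ->
  \sum_i pd j (christoffel rg i i k) p = df p j k + (n + n)%:R * d_dlog_rho p j k.
Proof.
move=> Up; rewrite -(hasD_val (hasD_D (hasD_dlog_vol_form j k Up)
  (hasD_Ml (n + n)%:R (hasD_dlog_rho j k Up)))).
rewrite -[RHS](pd_on _ oU Up (f := fun q => \sum_i christoffel rg i i k q)); last first.
  by move=> q Uq; rewrite trace_christoffel_rg.
apply/esym/hasD_val; apply: hasD_sum => i; apply: differentiable_hasD.
exact: hasD_differentiable (hasD_christoffel_rg j i i k Up).
Qed.

Lemma ricci_rg j k p : U p -> ricci rg j k p =
  \sum_i (dchristoffel i i j k p + ((i == j)%:R * d_dlog_rho p i k + (i == k)%:R * d_dlog_rho p i j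
            - (dmetric i j k p * grad_rho p i + g p j k * d_grad_rho p i i)))
    - (df p j k + (n + n)%:R * d_dlog_rho p j k)
    + \sum_r (christoffel g r j k p + corr (g p) (dlog_rho p) (grad_rho p) r j k)
        * (dlog_vol_form p r + (n + n)%:R * dlog_rho p r)
    - quad (fun l j k => christoffel g l j k p + corr (g p) (dlog_rho p) (grad_rho p) l j k)
         (fun l j k => christoffel g l j k p + corr (g p) (dlog_rho p) (grad_rho p) l j k) j k.
Proof.
move=> Up; rewrite -hasD_trace_rg// /ricci /riemann_curv big_split sumrB/=.
rewrite -!addrA; congr (_ + (_ + _)).
  by apply: eq_bigr => i _; exact: hasD_val (hasD_christoffel_rg i i j k Up).
under [LHS]eq_bigr do rewrite sumrB.
rewrite sumrB exchange_big /=; congr (_ - _).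
  apply: eq_bigr => r _; rewrite -trace_christoffel_rg// big_distrr.
  by rewrite -christoffel_rg.
by apply: eq_bigr => i _; apply: eq_bigr => r _; rewrite -!christoffel_rg.
Qed.

(** The Laplacian of a radial function, whose Hessian is
    2 x delta + 4 y p p^T with x and y its first two derivatives: here up to a
    factor 2. *)
Lemma contract_hess p (x y : R) : U p ->
  contract (gi p) (fun a b => (a == b)%:R * x + 2 * y * (p 0 a * p 0 b)) =
  x * ((n%:R - radial p * phi2 (radial p) / psi (radial p)) / phi1 (radial p))
  + y * (radial p / psi (radial p)).
Proof.
move=> Up; have x0 := phi1_neq0 Up; have xy0 := psi_neq0 Up.
rewrite contractD contractZ contract_inv_pp//.
rewrite (@eq_contract _ _ _ _ (fun a b => x * (a == b)%:R)); last first.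
  by move=> a b; rewrite mulrC.
by rewrite contractZ contract_inv_delta// /psi; field; rewrite x0 xy0.
Qed.

Lemma scalar_curv_rg p : U p -> let r := radial p in
  scalar_curv rg p = (rho r)^-1 * (
   - (2 * (dlog_vol r * ((n%:R - r * phi2 r / psi r) / phi1 r) + dlog_vol1 r * (r / psi r)))
   + (2 - (n + n)%:R) * (l r * ((n%:R - r * phi2 r / psi r) / phi1 r) + l1 r * (r / psi r))
   - (n + n)%:R * (2 * dlog_vol r * kap r * r)
   - (n + n)%:R * ((n + n)%:R * kap r + 2 * kap1 r * r)
   + (2 - (n + n)%:R) * ((n + n)%:R - 1) * (l r * kap r * r)).
Proof.
move=> Up r; have x0 := phi1_neq0 Up; have xy0 := psi_neq0 Up.
have -> : scalar_curv rg p = (rho r)^-1 * contract (gi p) (fun j k => ricci rg j k p).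
  rewrite /scalar_curv invmx_rg// -contractZ /contract.
  by apply: eq_bigr => j _; apply: eq_bigr => k _; rewrite mxE; ring.
congr (_ * _); rewrite (eq_contract _ (fun j k => ricci_rg j k Up)).
rewrite (contract_conformal_ricci (g_sym Up) (@radial_inv_sym _ _ _ _ _) (giG Up)
   (fun a => g_grad_rho a Up)).
- rewrite [contract _ (d_dlog_rho p)]contract_hess//.
  rewrite [contract _ (df p)]contractZ contract_hess//.
  have S0 (x y : R) : \sum_a (x * p 0 a) * (y * p 0 a) = x * y * r.
    by rewrite /r radialE big_distrr; apply: eq_bigr => a _ /=; ring.
  have -> : \sum_i dlog_vol_form p i * grad_rho p i = 2 * dlog_vol r * kap r * r.
    by rewrite -S0; apply: eq_bigr => a _; rewrite /dlog_vol_form /grad_rho -/r; ring.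
  have -> : \sum_i dlog_rho p i * grad_rho p i = l r * kap r * r by exact: S0.
  have -> // : \sum_i d_grad_rho p i i = (n + n)%:R * kap r + 2 * kap1 r * r.
  rewrite /d_grad_rho big_split/= -big_distrr/= -radialE; congr (_ + _).
  by under eq_bigr do rewrite eqxx mul1r; rewrite sumr_const card_ord mulr_natl.
- by move=> i j k; exact: christoffel_sym.
- move=> i; apply: (contract_Gam0 jswapK jsign2 jsign_swap (@radial_invJ _ _ _ _ _)
     (Gam := fun l j k => christoffel g l j k p)).
    by move=> *; exact: christoffel_sym.
  by move=> *; exact: christoffelJ.
- move=> i; apply: (contract_Gam0 jswapK jsign2 jsign_swap (@radial_invJ _ _ _ _ _)
     (Gam := fun l j k => dchristoffel i l j k p)).
    by move=> *; exact: dchristoffel_sym.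
  by move=> *; exact: dchristoffelJ.
- apply: (contract_quad_Gam0 jswapK jsign2 jsign_swap (@radial_invJ _ _ _ _ _)
     (Gam := fun l j k => christoffel g l j k p)).
    by move=> *; exact: christoffel_sym.
  by move=> *; exact: christoffelJ.
- by move=> i; rewrite contract_dmetric// /dlog_vol_form; ring.
Qed.

Lemma hermitian_mx_rg p : U p -> hermitian_mx rg p =
  (rho (radial p) * phi1 (radial p))%:C%:M + (rho (radial p) * phi2 (radial p))%:C *: zbarz_mx p.
Proof.
move=> Up; apply: hermitian_mx_radial; apply/matrixP => a b.
by rewrite mxE gE// !radial_metricE; ring.
Qed.

Lemma det_hermitian_rg p : (0 < n)%N -> U p -> complex.Re (\det (hermitian_mx rg p)) =
  rho (radial p) ^+ n * phi1 (radial p) ^+ n.-1 * psi (radial p).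
Proof.
move=> n0 Up; rewrite hermitian_mx_rg// /zbarz_mx scalemxAl det_rank1//; last first.
  by rewrite fmorph_eq0 mulf_neq0 ?rho_neq0 ?phi1_neq0.
rewrite -scalemxAr z_zbar mxE [_%:M _ _]mxE eqxx mulr1n -!rmorphM -rmorphD -rmorphXn -rmorphM /=.
have E (y : R) : y ^+ n = y * y ^+ n.-1 by rewrite -exprS prednK.
by rewrite exprMn E /psi; ring.
Qed.

Let log_det t := ln (rho t ^+ n * phi1 t ^+ n.-1 * psi t).
Let log_det1 t := n%:R * l t + dlog_vol t.

Lemma hasD_log_det t : (0 < n)%N -> I t -> hasD (1 : R) log_det t (log_det1 t).
Proof.
move=> n0 It; have r0 := rho_gt0 It; have x0 := phi1_gt0 It; have p0 := psi_gt0 It.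
apply: hasD_eq.
  apply: hasD_comp.
    apply/is_derive_hasD; apply: is_derive1_ln.
    by rewrite !mulr_gt0 ?exprn_gt0.
  apply: hasD_M; last exact: hasD_psi.
  by apply: hasD_M; apply: hasD_X; [exact: drho|exact: d1].
have E (y : R) : y ^+ n = y * y ^+ n.-1 by rewrite -exprS prednK.
have E1 (y : R) : y != 0 -> n.-1%:R * y ^+ n.-1.-1 = (n%:R - 1) * y ^+ n.-1 / y.
  have -> : n%:R - 1 = n.-1%:R :> R.
    by rewrite -[X in X%:R - _](prednK n0) mulrSr addrK.
  move=> y0; case: n.-1 => [|m]; rewrite ?mul0r//= exprS; field; exact: y0.
rewrite /log_det1 /dlog_vol /= E E1 ?lt0r_neq0//; field.
by rewrite !expf_neq0 ?lt0r_neq0.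
Qed.

Lemma chern_scalar_rg p : (0 < n)%N -> U p -> let r := radial p in
  2 * chern_scalar rg p = (- (2 * (rho r)^-1 *
    ((n%:R * l r + dlog_vol r) * ((n%:R - r * phi2 r / psi r) / phi1 r) +
     (n%:R * l1 r + dlog_vol1 r) * (r / psi r))))%:C.
Proof.
move=> n0 Up r; have x0 := phi1_neq0 Up; have xy0 := psi_neq0 Up.
have ric : chern_ricci rg p = - ((log_det1 r)%:C%:M + (n%:R * l1 r + dlog_vol1 r)%:C *: zbarz_mx p).
  rewrite /chern_ricci (@ddbar_radial _ _ _ _ _ log_det log_det1
    (fun t => n%:R * l1 t + dlog_vol1 t) _ oU UI _ _ _ Up)// => [t|t It|q Uq].
  - exact: hasD_log_det.
  - by apply: hasD_D; [apply: hasD_Ml; exact: dl|exact: d_dlog_vol].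
  - by rewrite det_hermitian_rg.
have c0 : (rho r * phi1 r)%:C != 0.
  by rewrite fmorph_eq0 mulf_neq0 ?rho_neq0.
have cE : (rho r * phi2 r)%:C / ((rho r * phi1 r)%:C + r%:C * (rho r * phi2 r)%:C) =
    (phi2 r / psi r)%:C.
  rewrite -rmorphM -rmorphD -fmorphV -rmorphM /psi; congr (real_complex R).
  have r0 : rho r != 0 by exact: rho_neq0.
  by field; rewrite xy0 mulrCA -mulrDr mulf_neq0.
have inv : invmx (hermitian_mx rg p) = (rho r * phi1 r)%:C^-1 *:
   (1%:M - (phi2 r / psi r)%:C *: zbarz_mx p).
  apply: mulmx1_invmx; rewrite hermitian_mx_rg// -cE.
  apply: idempotent_inverse (zbarz_mx2 p) => //.
  by rewrite -rmorphM -rmorphD fmorph_eq0 mulrCA -mulrDr mulf_neq0 ?rho_neq0.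
have -> : chern_scalar rg p = \tr (invmx (hermitian_mx rg p) *m chern_ricci rg p).
  by rewrite /chern_scalar exchange_big; apply: eq_bigr => j _; rewrite [RHS]mxE.
rewrite inv ric mulmxN -scalemxAl linearN /= linearZ /=.
rewrite (trace_idempotent _ _ _ (zbarz_mx2 p) (zbarz_mx_tr p)).
rewrite real_trace; congr (real_complex R).
have r0 : rho r != 0 by exact: rho_neq0.
by rewrite /log_det1 /psi -/r; field; rewrite r0 x0 xy0.
Qed.

Hypothesis I_gt0 : forall t, I t -> 0 < t.

(** The difference of the two sides is the left-hand side of the equation times
    - (2n - 2) r / (psi rho), which does not vanish as n >= 2. *)
Lemma klsc_iff_ode p : (2 <= n)%N -> U p ->
  (scalar_curv rg p)%:C = 2 * chern_scalar rg p <->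
  l1 (radial p) + ((2 * n - 1)%N)%:R / 2 * l (radial p) ^+ 2 +
    l (radial p) * (n%:R / radial p +
       (n%:R - 1) * phi2 (radial p) / phi1 (radial p)) = 0.
Proof.
move=> n2 Up; rewrite chern_scalar_rg ?(ltnW n2)//= scalar_curv_rg//=.
set r := radial p; have x0 := phi1_neq0 Up; have xy0 := psi_neq0 Up.
have r0 : r != 0 by rewrite gt_eqF// I_gt0.
have q0 : rho r != 0 by exact: rho_neq0.
have nE : ((2 * n - 1)%N)%:R = 2 * n%:R - 1 :> R.
  by rewrite natrB ?natrM// muln_gt0 (ltnW n2).
have n1 : (2 * n%:R - 2 : R) != 0.
  rewrite (_ : _ - _ = 2 * (n%:R - 1)); last by ring.
  by rewrite mulf_neq0 ?pnatr_eq0// subr_eq0 (eqr_nat _ n 1) gtn_eqF.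
set ode := (X in _ <-> X = 0).
have E A B : A - B = - ((2 * n%:R - 2) * (r / psi r) * (rho r)^-1 * ode) ->
    A%:C = B%:C <-> ode = 0.
  move=> AB; split=> [/complexI AB0|ode0].
    move: AB; rewrite AB0 subrr => /esym/eqP; rewrite oppr_eq0 !mulf_eq0 (negbTE n1).
    by rewrite (negbTE r0) !invr_eq0 (negbTE q0) (negbTE xy0)/= => /eqP.
  by congr (real_complex R); apply/eqP; rewrite -subr_eq0 AB ode0 mulr0 oppr0.
apply: E; rewrite /ode nE /kap1 /kap /dlog_vol /psi -/r natrD.
by field; rewrite q0 x0 xy0 r0.
Qed.

Let omega p a b := jsign a * g p (jswap a) b.

Lemma pd_assoc_rg p a b c : U p -> pd a (fun q => assoc_form rg q b c) p =
  rho (radial p) * (2 * l (radial p) * (p 0 a * omega p b c) +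
    jsign b * dmetric a (jswap b) c p).
Proof.
move=> Up; apply: hasD_val.
apply: (hasD_on oU Up _ (hasD_eq (hasD_Ml (jsign b) (hasD_rg a (jswap b) c Up)) _)).
  by move=> q Uq; rewrite /assoc_form mulJ0E.
by rewrite /omega /dlog_rho; ring.
Qed.

(** d(rho omega) = d rho /\ omega, since d omega = 0. *)
Lemma d_assoc_rg p a b c : U p ->
  pd a (fun q => assoc_form rg q b c) p + pd b (fun q => assoc_form rg q c a) p
  + pd c (fun q => assoc_form rg q a b) p =
  2 * rho (radial p) * l (radial p) *
   (p 0 a * omega p b c + p 0 b * omega p c a + p 0 c * omega p a b).
Proof.
move=> Up; rewrite !pd_assoc_rg//.
rewrite -[RHS]addr0 -(mulr0 (rho (radial p))) -(dmetric_closed a b c Up); ring.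
Qed.

Lemma omega_anti p a b : U p -> omega p a b = - omega p b a.
Proof.
move=> Up; rewrite /omega -{1}(jswapK b) gJ// jsign_swap (g_sym Up a).
transitivity (- (jsign a * jsign a * (jsign b * g p (jswap b) a))); first by ring.
by rewrite jsign2 mul1r.
Qed.

(** Contracting d r /\ omega with the inverse of omega gives (2n - 2) times
    d r, up to a factor: 2n from the trace, and - 1 from each of the
    other two terms. As p is not 0, this is not 0. *)
Lemma wedge_radial_neq0 p : (2 <= n)%N -> U p ->
  (forall a b c, p 0 a * omega p b c + p 0 b * omega p c a + p 0 c * omega p a b = 0) -> False.
Proof.
move=> n2 Up T0.
(* The inverse of omega. *)
pose Om c b := jsign b * gi p c (jswap b).
have omOm a b : \sum_c omega p a c * Om c b = (a == b)%:R.
  transitivity (jsign a * jsign b * \sum_c gi p (jswap b) c * g p c (jswap a)).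
    rewrite big_distrr; apply: eq_bigr => c _.
    by rewrite /omega /Om /= (g_sym Up _ c) (radial_inv_sym _ _ _ c); ring.
  rewrite giG// (inj_eq (inv_inj jswapK)) eq_sym.
  by case: eqP => [->|]; rewrite ?jsign2 ?mul1r ?mulr0.
have OmA c b : Om c b = - Om b c.
  rewrite /Om -{1}(jswapK c) radial_invJ jsign_swap radial_inv_sym.
  transitivity (- (jsign b * jsign b * (jsign c * gi p b (jswap c)))); first by ring.
  by rewrite jsign2 mul1r.
have p0 a : p 0 a = 0.
  have : \sum_b \sum_c (p 0 a * omega p b c + p 0 b * omega p c a + p 0 c * omega p a b) * Om c b = 0.
    by rewrite big1// => b _; rewrite big1// => c _; rewrite T0 mul0r.
  have -> : \sum_b \sum_c (p 0 a * omega p b c + p 0 b * omega p c a + p 0 c * omega p a b) * Om c b =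
      \sum_b (p 0 a * \sum_c omega p b c * Om c b) - \sum_b (p 0 b * \sum_c omega p a c * Om c b)
      - \sum_c (p 0 c * \sum_b omega p a b * Om b c).
    rewrite [X in _ - X](_ : _ = \sum_b \sum_c p 0 c * (omega p a b * Om b c)); last first.
      by rewrite exchange_big; apply: eq_bigr => c _; rewrite big_distrr.
    rewrite -!sumrB; apply: eq_bigr => b _; rewrite !big_distrr -!sumrB.
    by apply: eq_bigr => c _ /=; rewrite (omega_anti c a Up) (OmA b c); ring.
  have -> : \sum_b (p 0 a * \sum_c omega p b c * Om c b) = (n + n)%:R * p 0 a.
    under eq_bigr do rewrite omOm eqxx mulr1.
    by rewrite sumr_const card_ord mulr_natl.
  have S : \sum_b (p 0 b * \sum_c omega p a c * Om c b) = p 0 a.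
    under eq_bigr do rewrite omOm mulrC.
    by rewrite sum_deltal.
  rewrite S (_ : _ - _ - _ = ((n + n)%:R - 2%:R) * p 0 a); last by ring.
  move/eqP.
  rewrite mulf_eq0 subr_eq0 eqr_nat gtn_eqF ?(leq_trans _ (leq_add n2 n2))//.
  by move/eqP.
have : 0 < radial p by exact: I_gt0 (UI Up).
by rewrite radialE big1 ?ltxx// => a _; rewrite p0 mul0r.
Qed.

Lemma closed_rg_dlog0 : closed2 U (assoc_form rg) -> (2 <= n)%N ->
  forall p, U p -> l (radial p) = 0.
Proof.
move=> cl n2 p Up; apply/eqP; apply: contrapT => /negP l0.
apply: (wedge_radial_neq0 n2 Up) => a b c.
have := cl p a b c Up; rewrite d_assoc_rg// => /eqP; rewrite mulf_eq0 => /orP[|/eqP//].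
by rewrite !mulf_eq0 pnatr_eq0/= (negbTE (rho_neq0 Up)) (negbTE l0).
Qed.

Lemma dlog0_closed_rg : (forall p, U p -> l (radial p) = 0) -> closed2 U (assoc_form rg).
Proof. by move=> l0 p a b c Up; rewrite d_assoc_rg// l0// mulr0 mul0r. Qed.

End KahlerAnnulus.

(** * The differential equation for the conformal factor *)

Section OneVariable.
Context {R : realType} (al : R) (be : \bar R).
Local Notation I := (oint al be).

Lemma oint_between s t x : I s -> I t -> s <= x -> x <= t -> I x.
Proof.
move=> [als _] [_ tbe] sx xt; split; first exact: lt_le_trans sx.
by apply: le_lt_trans tbe; rewrite lee_fin.
Qed.

Lemma oint_nonempty : (al%:E < be)%E -> exists t, I t.
Proof.
case: be => [b| |]//; last by move=> _; exists (al + 1); split; rewrite ?ltry// ltrDl.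
rewrite lte_fin => ab; exists ((al + b) / 2); split; rewrite ?lte_fin.
  by rewrite midf_lt.
by rewrite midf_lt.
Qed.

Lemma hasD0_constant (f : R -> R) : (forall t, I t -> hasD (1 : R) f t 0) ->
  forall s t, I s -> I t -> f s = f t.
Proof.
move=> f0.
suff H s t : I s -> I t -> s <= t -> f s = f t.
  move=> s t Is It; have [st|/ltW ts] := leP s t; first exact: H.
  by apply/esym/H.
move=> Is It st.
have [||c _] := @MVT_segment R f (fun=> 0) s t st.
- move=> x; rewrite in_itv /= => /andP[sx xt]; apply/is_derive_hasD/f0.
  by apply: oint_between Is It _ _; exact: ltW.
- apply: derivable_within_continuous => x; rewrite in_itv /= => /andP[sx xt].
  by apply/derivable1_diffP/(hasD_differentiable (f0 x _))/(oint_between Is It).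
by rewrite mul0r => /eqP; rewrite subr_eq0 => /eqP.
Qed.

Lemma Ck_id k : Ck (fun _ : unit => 1 : R) I k (fun t => t).
Proof.
have d1 x : hasD (1 : R) (fun t => t) x 1.
  by apply/is_derive_hasD; exact: is_derive_id.
have dx x : differentiable (fun t : R => t) x by case: (d1 x).
case: k => [|k]; first by split.
apply: (CkS (open_oint (al := al) (be := be)) (df := fun _ _ => 1)) => //.
by move=> _; apply: Ck_cst; exact: open_oint.
Qed.

Lemma smooth1_derive1n f k : smooth1_on I f -> forall t, I t ->
  hasD (1 : R) (derive1n k f) t (derive1n k.+1 f t).
Proof.
move=> sf t It; apply/is_derive_hasD; rewrite derive1nS derive1E.
by apply/derivableP; exact: sf.
Qed.

Lemma smooth1_derive1 f : smooth1_on I f -> smooth1_on I (derive1 f).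
Proof. by move=> sf k t It; rewrite -derive1Sn; exact: sf. Qed.

End OneVariable.

Section OddRoot.
Context {R : realType} (m : nat).

(** The square of the odd root is a power of a positive number, whichever the
    sign of x; positivity is what differentiation of powers requires. *)
Lemma odd_root_sqr (x : R) : x != 0 -> odd_root m x ^+ 2 = (x ^+ 2) `^ (m%:R^-1).
Proof.
move=> x0; rewrite /odd_root exprMn sqr_sg x0 mul1r.
by rewrite -[in RHS]real_normK ?num_real// !expr2 powRM.
Qed.

Lemma odd_root_eq0 (x : R) : (odd_root m x == 0) = (x == 0).
Proof.
rewrite /odd_root mulf_eq0 sgr_eq0 powR_eq0 normr_eq0.
by case: (x == 0).
Qed.

Lemma hasD_powR (f : R -> R) (a t d : R) : 0 < f t -> hasD (1 : R) f t d ->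
  hasD (1 : R) (fun s => f s `^ a) t (a * f t `^ a * (d / f t)).
Proof.
move=> f0 fd; apply: hasD_eq.
  apply: (hasD_comp (k := fun y => y `^ a) _ fd).
  by apply/is_derive_hasD; exact: is_derive1_powR.
have -> : f t `^ (a - 1) = f t `^ a / f t.
  by rewrite powRB ?powRr1 ?ltW// (gt_eqF f0) implybT.
by field; rewrite gt_eqF.
Qed.

End OddRoot.

Section RadialKahlerAnnulus.
Context {R : realType} {n : nat} (n2 : (2 <= n)%N).
Context (al : R) (be : \bar R) (al0 : 0 <= al).
Local Notation pt := 'rV[R]_(n + n).
Local Notation I := (oint al be).
Local Notation U := (annulus n al be).
Context (phi : R -> R) (g : pt -> 'M[R]_(n + n)).
Hypothesis hg : kahler_metric U g.
Hypothesis hphi : kahler_potential al be phi g.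

Let phi1 := derive1n 1 phi.
Let phi2 := derive1n 2 phi.
Let phi3 := derive1n 3 phi.

Let phi_smooth : smooth1_on I phi. Proof. by case: hphi. Qed.
Let d1 t : I t -> hasD (1 : R) phi1 t (phi2 t).
Proof. exact: smooth1_derive1n. Qed.
Let d2 t : I t -> hasD (1 : R) phi2 t (phi3 t).
Proof. exact: smooth1_derive1n. Qed.
Let phi1_gt0 t : I t -> 0 < phi1 t.
Proof. by case: hphi => _ H _ _ It; exact: H. Qed.
Let I_gt0 t : I t -> 0 < t.
Proof. by case=> alt _; exact: le_lt_trans alt. Qed.
Let psi_gt0 t : I t -> 0 < phi1 t + t * phi2 t.
Proof.
case: hphi => _ _ H _ It; have := H t It; rewrite derive1E.
have E : hasD (1 : R) (fun s => s * derive1 phi s) t (1 * phi1 t + t * phi2 t).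
  apply: hasD_M; last exact: d1.
  by apply/is_derive_hasD; exact: is_derive_id.
by rewrite (hasD_val E) mul1r.
Qed.

Let gE p : U p -> g p = radial_metric (phi1 (radial p)) (phi2 (radial p)) p.
Proof.
case: hphi => _ _ _ H Up.
have H1 := H p Up.
apply: assoc_form_radial.
rewrite H1.
have d0 t : I t -> hasD (1 : R) phi t (phi1 t).
  by move=> It; exact: (smooth1_derive1n 0 phi_smooth It).
have E := @ddbar_radial R n U I (fun q => phi (radial q)) phi phi1 phi2 p
  (@open_annulus R n al be) (fun _ => id) d0 d1 (fun _ _ => erefl) Up.
exact: (congr1 (@form11 R n) E).
Qed.

Let g_smooth a b : smooth_on U (fun p => g p a b).
Proof. by case: hg => -[[]]. Qed.
Let g_closed : closed2 U (assoc_form g). Proof. by case: hg. Qed.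

Let dlog_vol1 t : R := 'D_1 (dlog_vol (n := n) phi1 phi2 phi3) t.
Let d_dlog_vol t : I t -> hasD (1 : R) (dlog_vol (n := n) phi1 phi2 phi3) t (dlog_vol1 t).
Proof.
move=> It; apply: differentiable_hasD; apply: (hasD_differentiable (v := 1 : R)).
have d3 : hasD (1 : R) phi3 t (derive1n 4 phi t).
  exact: (smooth1_derive1n 3 phi_smooth It).
have did : hasD (1 : R) (fun s => s) t 1.
  by apply/is_derive_hasD; exact: is_derive_id.
apply: hasD_D; apply: hasD_M.
- by apply: hasD_Ml; exact: d2.
- by apply: hasD_V; [rewrite gt_eqF ?phi1_gt0|exact: d1].
- by apply: hasD_D; [apply: hasD_Ml; exact: d2|apply: hasD_M; [exact: did|exact: d3]].
- apply: hasD_V; first by rewrite gt_eqF ?psi_gt0.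
  by apply: hasD_D; [exact: d1|apply: hasD_M; [exact: did|exact: d2]].
Qed.

(** Conditions on the annulus and on the interval of values of r are thus
    equivalent. *)
Lemma radial_onto t : I t -> exists2 p, U p & radial p = t.
Proof.
move=> It; have a : 'I_n by exact: Ordinal (ltnW n2).
pose p : pt := Num.sqrt t *: delta_mx 0 (lshift n a).
suff rp : radial p = t by exists p => //; rewrite /annulus /= rp.
rewrite radialE (bigD1 (lshift n a))//= big1 ?addr0 => [|b /negbTE ba].
  by rewrite /p !mxE !eqxx mulr1 -expr2 sqr_sqrtr// ltW// I_gt0.
by rewrite /p !mxE ba andbF mulr0 mul0r.
Qed.

Lemma hermitian_conformal (rho : R -> R) : smooth1_on I rho ->
  (forall t, I t -> 0 < rho t) ->
  hermitian_metric U (fun p => rho (radial p) *: g p).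
Proof.
move=> srho rho0; case: hg => -[[gs gsym gpos] gJ] _; split; first split.
- move=> a b; rewrite (_ : (fun p => _) = (fun p => rho (radial p) * g p a b)); last first.
    by apply/funext => p; rewrite mxE.
  apply: (smooth_on_radialM _ _ srho (gs a b)) => //; exact: open_annulus.
- by move=> p Up; rewrite linearZ /= gsym.
- move=> p u Up u0; rewrite -scalemxAr -scalemxAl mxE mulr_gt0 ?gpos//.
  exact: rho0.
- by move=> p X Y Up; rewrite -!scalemxAr -!scalemxAl gJ.
Qed.

(** The weight W of the radial Laplace equation (W F')' = 0. *)
Definition weight t := t ^+ n * derive1 phi t ^+ (n - 1).
Definition dlog_weight t := n%:R / t + (n%:R - 1) * phi2 t / phi1 t.

Lemma weight_neq0 t : I t -> weight t != 0.
Proof.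
move=> It; apply: mulf_neq0; apply: expf_neq0; apply: lt0r_neq0.
  exact: I_gt0.
exact: phi1_gt0.
Qed.

Lemma hasD_weight t : I t -> hasD (1 : R) weight t (weight t * dlog_weight t).
Proof.
move=> It; have t0 : t != 0 by rewrite gt_eqF ?I_gt0.
have x0 : phi1 t != 0 by rewrite gt_eqF ?phi1_gt0.
have did : hasD (1 : R) (fun s => s) t 1.
  by apply/is_derive_hasD; exact: is_derive_id.
apply: hasD_eq.
  by apply: hasD_M; apply: hasD_X; [exact: did|exact: d1].
have powE (y : R) k : y != 0 -> k%:R * y ^+ k.-1 = k%:R * y ^+ k / y.
  by move=> y0; case: k => [|k]; rewrite ?mul0r//= exprS; field.
rewrite !powE// /weight /dlog_weight -[derive1 phi]/phi1 natrB ?(ltnW n2)//.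
by field; rewrite t0 x0.
Qed.

Section ConformalFactor.
Context (rho l l1 : R -> R).
Hypothesis rho_smooth : smooth1_on I rho.
Hypothesis rho_gt0 : forall t, I t -> 0 < rho t.
Hypothesis dl : forall t, I t -> hasD (1 : R) l t (l1 t).
Hypothesis drho : forall t, I t -> hasD (1 : R) rho t (rho t * l t).
Local Notation rg := (fun p : pt => rho (radial p) *: g p).

(** The non-Kahler condition asks for one point where rho is not stationary:
    rho omega is closed iff rho is locally constant. *)
Lemma non_kahler_klsc_iff_ode : non_kahler_klsc U rg <->
  (forall t, I t -> l1 t + ((2 * n - 1)%N)%:R / 2 * l t ^+ 2 + l t * dlog_weight t = 0)
  /\ exists2 t, I t & l t != 0.
Proof.
have ode p := klsc_iff_ode d1 d2 phi1_gt0 psi_gt0 gE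
  g_smooth g_closed dl drho rho_gt0 d_dlog_vol I_gt0 (p := p) n2.
have herm := hermitian_conformal rho_smooth rho_gt0.
split=> [[[_ klsc] nk]|[odeI [t It lt0]]].
- split=> [t It|].
    have [p Up rp] := radial_onto It.
    by have := (ode p Up).1 (klsc p Up); rewrite rp.
  apply: contrapT => nl; apply: nk; split=> //.
  apply: (dlog0_closed_rg g_smooth g_closed drho) => p Up.
  by apply/eqP; apply: contrapT => /negP l0; apply: nl; exists (radial p).
- split; first by split=> // p Up; apply/(ode p Up)/odeI.
  move=> [_ cl]; have [p Up rp] := radial_onto It.
  move: lt0; rewrite -rp => /eqP; apply.
  exact: (closed_rg_dlog0 phi1_gt0 psi_gt0 gE g_smooth g_closed drho rho_gt0 I_gt0 cl n2 Up).
Qed.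

End ConformalFactor.

Lemma Ck_weight k : Ck (fun _ : unit => 1 : R) I k weight.
Proof.
have oI := @open_oint R al be; apply: (CkM oI).
  by apply: (CkX oI); exact: Ck_id.
apply: (CkX oI); apply: (smooth1_on_Ck _ _).1.
exact: smooth1_derive1.
Qed.

Let N : R := ((2 * n - 1)%N)%:R.
Let N_gt0 : 0 < N.
Proof. by rewrite ltr0n subn_gt0; case: n n2 => [|[|m]]. Qed.

(** With F' = 1 / W and v^2 = (F^2)^(1/(2n-1)), the logarithmic derivative of v^2
    is 2 / ((2n - 1) W F), which solves the equation and never vanishes. *)
Lemma klsc_factor_non_kahler (hab : (al%:E < be)%E) v :
  klsc_factor n al be phi v ->
  non_kahler_klsc U (fun p => v (radial p) ^+ 2 *: g p).
Proof.
move=> [F [dF vE v0]]; have oI := @open_oint R al be.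
have F0 t : I t -> F t != 0.
  by move=> It; rewrite -(odd_root_eq0 (2 * n - 1)) -vE// v0.
pose l t := 2 / N * (weight t * F t)^-1.
have hF t : I t -> hasD (1 : R) F t (weight t)^-1 by move=> It; apply/is_derive_hasD/dF.
have dwF t : I t -> hasD (1 : R) (fun s => weight s * F s) t
    (weight t * dlog_weight t * F t + weight t * (weight t)^-1).
  by move=> It; apply: hasD_M; [exact: hasD_weight|exact: hF].
have wF0 t : I t -> weight t * F t != 0.
  by move=> It; rewrite mulf_neq0 ?weight_neq0 ?F0.
have drho t : I t -> hasD (1 : R) (fun s => v s ^+ 2) t (v t ^+ 2 * l t).
  move=> It; apply: (hasD_on (f := fun s => (F s ^+ 2) `^ N^-1) oI It).
    by move=> s Is; rewrite vE// odd_root_sqr ?F0.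
  apply: hasD_eq.
    apply: hasD_powR; first by rewrite exprn_even_gt0//= F0.
    by apply: hasD_X; exact: hF.
  rewrite vE// odd_root_sqr ?F0// /l /=; field.
  by rewrite (F0 t It) weight_neq0 ?gt_eqF ?N_gt0.
pose l1 t := - (l t * dlog_weight t) - N / 2 * l t ^+ 2.
have dl t : I t -> hasD (1 : R) l t (l1 t).
  move=> It; apply: hasD_eq.
    by apply: hasD_Ml; apply: hasD_V (dwF t It); exact: wF0.
  rewrite /l1 /l; field.
  by rewrite (F0 t It) weight_neq0 ?gt_eqF ?N_gt0.
have rho0 t : I t -> 0 < v t ^+ 2 by move=> It; rewrite exprn_even_gt0//= v0.
have CF k : Ck (fun _ : unit => 1 : R) I k F.
  case: k => [|k]; first by split=> // t It; exact: hasD_differentiable (hF t It).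
  apply: (CkS oI (df := fun _ t => (weight t)^-1)).
  - by move=> _ t It; exact: hF.
  - by move=> t It; exact: hasD_differentiable (hF t It).
  - by move=> _; apply: (CkV oI) => [t It|]; [exact: weight_neq0|exact: Ck_weight].
have srho : smooth1_on I (fun t => v t ^+ 2).
  apply/smooth1_on_Ck => k.
  apply: (@Ck_ode _ _ _ _ _ oI k _ (fun _ => l)) => [t It|_ t It|_ j].
  - exact: hasD_differentiable (drho t It).
  - exact: drho.
  - apply: (CkM oI); first exact: Ck_cst.
    apply: (CkV oI) => [t It|]; first exact: wF0.
    by apply: (CkM oI) => //; exact: Ck_weight.
have := non_kahler_klsc_iff_ode srho rho0 dl drho.
move=> /= -> ; split=> [t It|]; first by rewrite /l1 -/N; ring.
have [t It] := oint_nonempty hab; exists t => //.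
by rewrite /l mulf_neq0 ?invr_eq0 ?wF0// mulf_neq0 ?pnatr_eq0// invr_eq0 gt_eqF ?N_gt0.
Qed.

(** For a solution, W E l is constant, where E = rho^((2n-1)/2): its derivative is
    W E times the equation. As E' = (2n - 1)/2 l E, the constant multiple
    F = E / K, where K = (2n - 1)/2 W E l, has F' = 1 / W. The constant K is not 0
    because l does not vanish identically, and its sign is absorbed by the odd
    root. *)
Lemma non_kahler_klsc_factor (rho : R -> R) :
  smooth1_on I rho -> (forall t, I t -> 0 < rho t) ->
  non_kahler_klsc U (fun p => rho (radial p) *: g p) ->
  exists c : R, exists v : R -> R,
    [/\ 0 < c, klsc_factor n al be phi v
      & forall t, I t -> rho t = c * v t ^+ 2].
Proof.
move=> srho rho0 klsc; have oI := @open_oint R al be.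
pose l t := derive1 rho t * (rho t)^-1.
have rhon t : I t -> rho t != 0 by move=> It; rewrite gt_eqF ?rho0.
have drho1 t : I t -> hasD (1 : R) rho t (derive1 rho t).
  by move=> It; exact: (smooth1_derive1n 0 srho It).
have drho t : I t -> hasD (1 : R) rho t (rho t * l t).
  by move=> It; apply: hasD_eq (drho1 t It) _; rewrite /l mulrCA divff ?mulr1// rhon.
have dl t : I t -> hasD (1 : R) l t ('D_1 l t).
  move=> It; apply: differentiable_hasD; apply: (hasD_differentiable (v := 1 : R)).
  apply: hasD_M; first exact: (smooth1_derive1n 1 srho It).
  by apply: hasD_V (drho1 t It); exact: rhon.
have [ode [t0 It0 lt0]] := (non_kahler_klsc_iff_ode srho rho0 dl drho).1 klsc.
pose E t := rho t `^ (N / 2).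
have E0 t : I t -> 0 < E t by move=> It; rewrite powR_gt0 ?rho0.
have dE t : I t -> hasD (1 : R) E t (N / 2 * l t * E t).
  move=> It; apply: hasD_eq (hasD_powR (N / 2) (rho0 t It) (drho t It)) _.
  by rewrite /E; field; exact: rhon.
(* The flux of the harmonic function E, up to the factor (2n-1)/2. *)
pose Q t := weight t * E t * l t.
have dQ t : I t -> hasD (1 : R) Q t 0.
  move=> It; apply: hasD_eq.
    apply: hasD_M (dl t It); apply: hasD_M (dE t It); exact: hasD_weight.
  rewrite -(mulr0 (weight t * E t)) -(ode t It) -/N; ring.
pose K := N / 2 * Q t0.
have K0 : K != 0.
  apply: mulf_neq0.
    by apply: mulf_neq0; [exact: lt0r_neq0|rewrite invr_eq0 pnatr_eq0].
  apply: mulf_neq0 lt0; apply: mulf_neq0; first exact: weight_neq0.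
  by apply: lt0r_neq0; exact: E0.
have QK t : I t -> N / 2 * Q t = K.
  by move=> It; rewrite /K (hasD0_constant dQ It It0).
pose F t := E t / K.
have F0 t : I t -> F t != 0.
  by move=> It; rewrite mulf_neq0 ?invr_eq0// gt_eqF ?E0.
exists ((K ^+ 2) `^ N^-1), (fun t => odd_root (2 * n - 1) (F t)); split.
- by rewrite powR_gt0// exprn_even_gt0//= K0.
- exists F; split=> // t It; last by rewrite odd_root_eq0 F0.
  apply/is_derive_hasD; apply: hasD_eq.
    by apply: hasD_M; [exact: dE|exact: hasD_cst].
  have w0 := weight_neq0 It; rewrite -/(weight t) mulr0 addr0 -(QK t It) /Q /=.
  have e0 := lt0r_neq0 (E0 t It); have n0 := lt0r_neq0 N_gt0.
  have l0 : l t != 0.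
    by apply/eqP => l0; move: K0; rewrite -(QK t It) /Q l0 !mulr0 eqxx.
  by field; rewrite n0 w0 e0 l0.
- move=> t It; rewrite odd_root_sqr ?F0// -powRM ?sqr_ge0// -exprMn.
  rewrite /F mulrCA divff// mulr1 /E -powR_mulrn ?powR_ge0// -!powRrM.
  rewrite (_ : N / 2 * (2 / N) = 1) ?powRr1 ?ltW ?rho0//.
  by field; rewrite gt_eqF ?N_gt0.
Qed.

End RadialKahlerAnnulus.

Theorem theorem1p2 (R : realType) (n : nat) (hn : (2 <= n)%N)
  (alpha : R) (beta : \bar R) (halpha : 0 <= alpha)
  (hbeta : (alpha%:E < beta)%E)
  (phi : R -> R) (g : 'rV[R]_(n + n) -> 'M[R]_(n + n))
  (hg : kahler_metric (annulus n alpha beta) g)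
  (hphi : kahler_potential alpha beta phi g) :
  (forall v : R -> R, klsc_factor n alpha beta phi v ->
     non_kahler_klsc (annulus n alpha beta)
       (fun p => v (radial p) ^+ 2 *: g p)) /\
  (forall rho : R -> R,
     smooth1_on (oint alpha beta) rho ->
     (forall t, oint alpha beta t -> 0 < rho t) ->
     non_kahler_klsc (annulus n alpha beta) (fun p => rho (radial p) *: g p) ->
     exists c : R, exists v : R -> R,
       [/\ 0 < c, klsc_factor n alpha beta phi v
         & forall t, oint alpha beta t -> rho t = c * v t ^+ 2]).
Proof.
split=> [v hv|rho].
  exact: (klsc_factor_non_kahler hn halpha hg hphi hbeta hv).
exact: (non_kahler_klsc_factor hn halpha hg hphi).
Qed.
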